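(* Let $X$ and $Y$ be two superreflexive real Banach spaces. Then the following are equivalent: (1) the injective tensor product $X\widehat{\otimes}_\varepsilon Y$ is superreflexive; (2) either $X$ or $Y$ is finite-dimensional.
   Context: All Banach spaces are real. $X^*$ is the topological dual of $X$ and $S_{X^*}$ is the unit sphere of $X^*$. Finite representability: a Banach space $W$ is finitely representable in a Banach space $V$ if for every finite-dimensional subspace $E$ of $W$ and every $\varepsilon>0$ there exist a finite-dimensional subspace $F$ of $V$ and a linear bijection $T:E\to F$ with $\|T\|\,\|T^{-1}\|\le 1+\varepsilon$. Superreflexivity: a Banach space $V$ is superreflexive if every Banach space $W$ which is finitely representable in $V$ is reflexive. Injective tensor product: $X\widehat{\otimes}_\varepsilon Y$ is the completion of the algebraic tensor product $X\otimes Y$ with respect to the norm $\|u\|_\varepsilon=\sup\left\{\left|\sum_{i=1}^n x^*(x_i)y^*(y_i)\right| : x^*\in S_{X^*},\ y^*\in S_{Y^*}\right\}$ for $u=\sum_{i=1}^n x_i\otimes y_i$ (with the supremum of the empty set taken to be $0$). *)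

(* Defs.v *)
From HB Require Import structures.
From mathcomp Require Import all_boot all_order all_algebra.
From mathcomp Require Import all_classical all_reals all_analysis.

Set Implicit Arguments.
Unset Strict Implicit.
Unset Printing Implicit Defensive.

Import Order.TTheory GRing.Theory Num.Theory.
Import numFieldNormedType.Exports.

Local Open Scope classical_set_scope.
Local Open Scope ring_scope.

Section OperatorNorm.
Context {R : realType} {V W : normedModType R}.

(* Norm of the restriction of [T] to [E], for [E] a linear subspace.  The
   supremum is over a nonempty set, so it is the usual operator norm as soon as
   that set is bounded above: this is the case for every continuous linear map
   and for every linear map on a finite-dimensional [E]. *)
Definition opnorm (E : set V) (T : V -> W) : R :=
  sup [set `|T x| | x in E `&` [set x | `|x| <= 1]].

End OperatorNorm.

Section Dual.
Context {R : realType} (X : normedModType R).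

Definition lincont : {pred X -> R^o} :=
  fun f => `[< linear f /\ continuous f >].

Record dual := Dual {dual_fun :> X -> R^o ; dual_funP : dual_fun \in lincont}.

HB.instance Definition _ := [isSub for dual_fun].
HB.instance Definition _ := [Choice of dual by <:].

Lemma lincontP (f : X -> R^o) :
  reflect (linear f /\ continuous f) (f \in lincont).
Proof. exact: asboolP. Qed.

Lemma lincont_submod_closed : submod_closed lincont.
Proof.
split.
  apply/lincontP; split=> [a x y|x]; last exact: cvg_cst.
  exact: (esym (etrans (addr0 _) (scaler0 _ _))).
move=> a f g /lincontP[fl fc] /lincontP[gl gc]; apply/lincontP; split.
  move=> b x y; rewrite -[LHS]/(a *: f (b *: x + y) + g (b *: x + y)).
  rewrite -[RHS]/(b *: (a *: f x + g x) + (a *: f y + g y)) fl gl.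
  by rewrite !scalerDr !scalerA [a * b]mulrC addrACA.
by move=> x; apply: cvgD; [apply: cvgZr; exact: fc|exact: gc].
Qed.

HB.instance Definition _ :=
  GRing.isSubmodClosed.Build R (X -> R^o) lincont lincont_submod_closed.
HB.instance Definition _ := [SubChoice_isSubLmodule of dual by <:].

Lemma dual_linear (f : dual) : linear f.
Proof. by have /lincontP[] := dual_funP f. Qed.

HB.instance Definition _ (f : dual) :=
  GRing.isLinear.Build R X R^o _ (dual_fun f) (dual_linear f).

Lemma dual_continuous (f : dual) : continuous f.
Proof. by have /lincontP[] := dual_funP f. Qed.

Lemma dualDE (f g : dual) x : (f + g) x = f x + g x. Proof. by []. Qed.
Lemma dualZE a (f : dual) x : (a *: f) x = a * f x. Proof. by []. Qed.

Let dnorm (f : dual) : R := opnorm setT f.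

Lemma dual_has_sup (f : dual) :
  has_sup [set `|f x| | x in setT `&` [set x | `|x| <= 1]].
Proof.
split; first by exists `|f 0|, 0 => //; split => //=; rewrite normr0.
have := @continuous_linear_bounded _ _ _ 0 f (@dual_continuous f 0).
move=> /bounded_funP/(_ 1)[M fM]; exists M => _ [x [_ /= x1] <-]; exact: fM.
Qed.

Let dnorm_ub (f : dual) x : `|x| <= 1 -> `|f x| <= dnorm f.
Proof.
by move=> x1; apply: ub_le_sup; [have [] := dual_has_sup f|exists x].
Qed.

Let dnorm_lub (f : dual) C : (forall x, `|x| <= 1 -> `|f x| <= C) ->
  dnorm f <= C.
Proof.
move=> fC; apply: ge_sup; first by have [] := dual_has_sup f.
by move=> _ [x [_ /= x1] <-]; exact: fC.
Qed.

Let dnorm_ge0 (f : dual) : 0 <= dnorm f.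
Proof. by apply: le_trans (dnorm_ub f (x := 0) _); rewrite ?normr0. Qed.

Let dnorm_le (f : dual) x : `|f x| <= dnorm f * `|x|.
Proof.
have [->|x0] := eqVneq x 0; first by rewrite raddf0 !normr0 mulr0.
have x_gt0 : 0 < `|x| by rewrite normr_gt0.
rewrite -ler_pdivrMr// mulrC.
have -> : `|x|^-1 * `|f x| = `|f (`|x|^-1 *: x)|.
  by rewrite linearZ normrZ ger0_norm// invr_ge0.
by apply: dnorm_ub; rewrite normrZ normfV normr_id mulVf ?gt_eqF.
Qed.

Let dnormD (f g : dual) : dnorm (f + g) <= dnorm f + dnorm g.
Proof.
apply: dnorm_lub => x x1; rewrite dualDE (le_trans (ler_normD _ _))//.
by rewrite lerD// dnorm_ub.
Qed.

Let dnormZ_le a (f : dual) : dnorm (a *: f) <= `|a| * dnorm f.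
Proof.
by apply: dnorm_lub => x x1; rewrite dualZE normrM ler_wpM2l// dnorm_ub.
Qed.

Let dnormZ a (f : dual) : dnorm (a *: f) = `|a| * dnorm f.
Proof.
apply/eqP; rewrite eq_le dnormZ_le/=.
have [->|a0] := eqVneq a 0; first by rewrite normr0 mul0r dnorm_ge0.
rewrite -ler_pdivlMl ?normr_gt0// -normfV.
by rewrite -{1}[f](scale1r f) -(mulVf a0) -scalerA dnormZ_le.
Qed.

Let dnorm_eq0 (f : dual) : dnorm f = 0 -> f = 0.
Proof.
move=> f0; apply/val_inj/funext => x /=.
by have := dnorm_le f x; rewrite f0 mul0r normr_le0 => /eqP.
Qed.

HB.instance Definition _ :=
  @Lmodule_isNormed.Build R dual dnorm dnormD dnormZ dnorm_eq0.

Lemma dual_normE (f : dual) : `|f| = opnorm setT f. Proof. by []. Qed.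

Lemma dual_norm_le (f : dual) x : `|f x| <= `|f| * `|x|.
Proof. exact: dnorm_le. Qed.

End Dual.

Section Superreflexive.
Context {R : realType}.

(* Surjectivity of the canonical embedding of [V] into its bidual. *)
Definition reflexive_space (V : normedModType R) :=
  forall phi : dual (dual V), exists x : V, forall f : dual V, phi f = f x.

(* A finite-dimensional linear subspace, i.e. the linear span of finitely many
   vectors. *)
Definition fin_dim_subspace (V : lmodType R) (E : set V) :=
  exists (n : nat) (e : 'I_n -> V),
    E = range (fun c : 'I_n -> R => \sum_(i < n) c i *: e i).

Definition finite_dimensional (V : lmodType R) :=
  fin_dim_subspace [set: V].

(* [T] and [S] are total functions of which only the restrictions to [E] and
   [F] matter; [S] plays the role of the inverse of [T : E -> F]. *)
Definition finitely_representable (W V : normedModType R) :=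
  forall (E : set W) (eps : R), fin_dim_subspace E -> 0 < eps ->
  exists (F : set V) (T : W -> V) (S : V -> W),
    [/\ fin_dim_subspace F,
        forall (a : R) x y, E x -> E y -> T (a *: x + y) = a *: T x + T y,
        set_bij E F T,
        {in E, cancel T S} &
        opnorm E T * opnorm F S <= 1 + eps].

Definition superreflexive (V : completeNormedModType R) :=
  forall W : completeNormedModType R,
    finitely_representable W V -> reflexive_space W.

End Superreflexive.

Section Tensor.
Context {R : realType} (X Y : lmodType R).

(* A list [:: (x1, y1); ..; (xn, yn)] stands for the formal sum of the
   [xi (x) yi], and scalars are absorbed in the left factor.  The algebraic
   tensor product is the quotient by the congruence generated by
   bilinearity. *)
Inductive tensor_rel : seq (X * Y) -> seq (X * Y) -> Prop :=
| tensor_refl u : tensor_rel u u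
| tensor_sym u v : tensor_rel u v -> tensor_rel v u
| tensor_trans u v w : tensor_rel u v -> tensor_rel v w -> tensor_rel u w
| tensor_perm u v : perm_eq u v -> tensor_rel u v
| tensor_cat u v w : tensor_rel u v -> tensor_rel (u ++ w) (v ++ w)
| tensor_0 y : tensor_rel [:: (0, y)] [::]
| tensor_Dl x x' y : tensor_rel [:: (x + x', y)] [:: (x, y); (x', y)]
| tensor_Dr x y y' : tensor_rel [:: (x, y + y')] [:: (x, y); (x, y')]
| tensor_Z (a : R) x y : tensor_rel [:: (a *: x, y)] [:: (x, a *: y)].

Definition tensor_relb u v := `[< tensor_rel u v >].

Let tensor_relb_refl : reflexive tensor_relb.
Proof. by move=> u; apply/asboolP; exact: tensor_refl. Qed.

Let tensor_relb_sym : symmetric tensor_relb.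
Proof. by move=> u v; apply/asboolP/asboolP; exact: tensor_sym. Qed.

Let tensor_relb_trans : transitive tensor_relb.
Proof.
by move=> v u w /asboolP uv /asboolP vw; apply/asboolP/(tensor_trans uv vw).
Qed.

Canonical tensor_relb_canonical :=
  EquivRel tensor_relb tensor_relb_refl tensor_relb_sym tensor_relb_trans.

Local Open Scope quotient_scope.

Definition tensor : Type := {eq_quot tensor_relb}.
HB.instance Definition _ := Choice.on tensor.
HB.instance Definition _ := EqQuotient.on tensor.

Lemma tensorP u v : (\pi_tensor u = \pi_tensor v) <-> tensor_rel u v.
Proof.
by split=> [/eqmodP/asboolP//|uv]; apply/eqmodP/asboolP.
Qed.

Lemma tensor_reprP u : tensor_rel (repr (\pi_tensor u)) u.
Proof. by apply/tensorP; rewrite reprK. Qed.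

Lemma tensor_catr u v w : tensor_rel u v -> tensor_rel (w ++ u) (w ++ v).
Proof.
move=> uv; apply: tensor_trans (tensor_perm _) _; first exact: (permEl (perm_catC _ _)).
apply: tensor_trans (tensor_cat w uv) (tensor_perm _).
exact: (permEl (perm_catC _ _)).
Qed.

Lemma tensor_cat2 u u' v v' : tensor_rel u u' -> tensor_rel v v' ->
  tensor_rel (u ++ v) (u' ++ v').
Proof.
by move=> uu' vv'; exact: tensor_trans (tensor_cat v uu') (tensor_catr u' vv').
Qed.

Let scl (a : R) (u : seq (X * Y)) := [seq (a *: p.1, p.2) | p <- u].

Let tensor_scl a u v : tensor_rel u v -> tensor_rel (scl a u) (scl a v).
Proof.
elim=> {u v} [u|u v _|u v w _ uv _|u v uv|u v w _|y|x x' y|x y y'|b x y].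
- exact: tensor_refl.
- exact: tensor_sym.
- exact: tensor_trans.
- by apply: tensor_perm; exact: perm_map.
- by rewrite /scl !map_cat; exact: tensor_cat.
- by rewrite /scl/= scaler0; exact: tensor_0.
- by rewrite /scl/= scalerDr; exact: tensor_Dl.
- exact: tensor_Dr.
- by rewrite /scl/= scalerA mulrC -scalerA; exact: tensor_Z.
Qed.

Definition tensor_zero : tensor := \pi_tensor [::].
Definition tensor_add (s t : tensor) : tensor := \pi_tensor (repr s ++ repr t).
Definition tensor_scale (a : R) (s : tensor) : tensor :=
  \pi_tensor [seq (a *: p.1, p.2) | p <- repr s].
Definition tensor_opp (s : tensor) : tensor := tensor_scale (- 1) s.

Lemma tensor_addE u v :
  tensor_add (\pi_tensor u) (\pi_tensor v) = \pi_tensor (u ++ v).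
Proof. by apply/tensorP; apply: tensor_cat2; exact: tensor_reprP. Qed.

Lemma tensor_scaleE a u : tensor_scale a (\pi_tensor u) =
  \pi_tensor [seq (a *: p.1, p.2) | p <- u].
Proof. by apply/tensorP; apply: tensor_scl; exact: tensor_reprP. Qed.

Let tensor_addA : associative tensor_add.
Proof.
elim/quotW=> u; elim/quotW=> v; elim/quotW=> w.
rewrite (tensor_addE v w) (tensor_addE u) (tensor_addE u v).
by rewrite (tensor_addE (u ++ v)) catA.
Qed.

Let tensor_addC : commutative tensor_add.
Proof.
move=> s t; apply/tensorP/tensor_perm; exact: (permEl (perm_catC _ _)).
Qed.

Let tensor_add0 : left_id tensor_zero tensor_add.
Proof. by elim/quotW=> u; exact: tensor_addE. Qed.

Let tensor_scaleDl_seq a b (u : seq (X * Y)) :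
  tensor_rel (scl (a + b) u) (scl a u ++ scl b u).
Proof.
elim: u => [|[x y] u IH] /=; first exact: tensor_refl.
rewrite scalerDl.
apply: tensor_trans
  (tensor_cat2 (u := [:: _]) (v := scl (a + b) u) (tensor_Dl _ _ _) IH) _.
apply: tensor_perm; rewrite /= perm_cons perm_sym.
by rewrite -cat1s perm_catCA /=.
Qed.

Let tensor_scale0_seq (u : seq (X * Y)) : tensor_rel (scl 0 u) [::].
Proof.
elim: u => [|[x y] u IH] /=; first exact: tensor_refl.
rewrite scale0r.
exact: (tensor_cat2 (u := [:: _]) (u' := [::]) (tensor_0 _) IH).
Qed.

Let tensor_addN : left_inverse tensor_zero tensor_opp tensor_add.
Proof.
elim/quotW=> u; rewrite /tensor_opp (tensor_scaleE _ u).
rewrite (tensor_addE (scl (-1) u) u).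
apply/tensorP; have := tensor_scaleDl_seq (-1) 1 u.
rewrite addNr [scl 1 _](_ : _ = u); last first.
  by rewrite /scl -[RHS]map_id; apply: eq_map => -[x y]; rewrite /= scale1r.
move=> /tensor_sym h; apply: tensor_trans h _; exact: tensor_scale0_seq.
Qed.

HB.instance Definition _ := GRing.isZmodule.Build tensor
  tensor_addA tensor_addC tensor_add0 tensor_addN.

Let tensor_scaleA a b s :
  tensor_scale a (tensor_scale b s) = tensor_scale (a * b) s.
Proof.
elim/quotW: s => u; rewrite (tensor_scaleE b u) (tensor_scaleE a (scl b u)).
rewrite (tensor_scaleE (a * b) u) -map_comp; congr (\pi_tensor _).
by apply: eq_map => -[x y] /=; rewrite scalerA.
Qed.

Let tensor_scale1 : left_id 1 tensor_scale.
Proof.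
elim/quotW=> u; rewrite (tensor_scaleE 1 u); congr (\pi_tensor _).
by rewrite -[RHS]map_id; apply: eq_map => -[x y]; rewrite /= scale1r.
Qed.

Let tensor_scaleDr : right_distributive tensor_scale +%R.
Proof.
move=> a; elim/quotW=> u; elim/quotW=> v.
rewrite -[LHS]/(tensor_scale a (tensor_add (\pi u) (\pi v))).
rewrite -[RHS]/(tensor_add (tensor_scale a (\pi u)) (tensor_scale a (\pi v))).
rewrite (tensor_addE u v) (tensor_scaleE a (u ++ v)) (tensor_scaleE a u).
by rewrite (tensor_scaleE a v) (tensor_addE (scl a u) (scl a v)) map_cat.
Qed.

Let tensor_scaleDl s : {morph tensor_scale^~ s : a b / a + b}.
Proof.
elim/quotW: s => u a b.
rewrite -[RHS]/(tensor_add (tensor_scale a (\pi u)) (tensor_scale b (\pi u))).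
rewrite (tensor_scaleE (a + b) u) (tensor_scaleE a u) (tensor_scaleE b u).
rewrite (tensor_addE (scl a u) (scl b u)).
by apply/tensorP; exact: tensor_scaleDl_seq.
Qed.

HB.instance Definition _ := GRing.Zmodule_isLmodule.Build R tensor
  tensor_scaleA tensor_scale1 tensor_scaleDr tensor_scaleDl.

Definition tens (x : X) (y : Y) : tensor := \pi_tensor [:: (x, y)].

Let pi_cat u v : \pi_tensor (u ++ v) = \pi_tensor u + \pi_tensor v.
Proof. exact/esym/tensor_addE. Qed.

Let pi_scale a u :
  \pi_tensor [seq (a *: p.1, p.2) | p <- u] = a *: \pi_tensor u.
Proof. exact/esym/tensor_scaleE. Qed.

Lemma tensDl x x' y : tens (x + x') y = tens x y + tens x' y.
Proof. by rewrite /tens -pi_cat; apply/tensorP; exact: tensor_Dl. Qed.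

Lemma tensDr x y y' : tens x (y + y') = tens x y + tens x y'.
Proof. by rewrite /tens -pi_cat; apply/tensorP; exact: tensor_Dr. Qed.

Lemma tensZl a x y : tens (a *: x) y = a *: tens x y.
Proof. by rewrite /tens -pi_scale. Qed.

Lemma tensZr a x y : tens x (a *: y) = a *: tens x y.
Proof. by rewrite -tensZl; apply/tensorP; exact/tensor_sym/tensor_Z. Qed.

Lemma pi_tensorE u : \pi_tensor u = \sum_(p <- u) tens p.1 p.2.
Proof.
elim: u => [|[x y] u IH]; first by rewrite big_nil.
by rewrite big_cons -IH /tens -pi_cat.
Qed.

Lemma tensor_reprE (u : tensor) : u = \sum_(p <- repr u) tens p.1 p.2.
Proof. by rewrite -pi_tensorE reprK. Qed.

(* The universal property: a bilinear map factors through [tensor]. *)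
Definition tensor_lift {Z : lmodType R} (b : X -> Y -> Z) (u : tensor) : Z :=
  \sum_(p <- repr u) b p.1 p.2.

Section Lift.
Context {Z : lmodType R} (b : X -> Y -> Z).
Hypothesis bl : forall y, linear (b^~ y).
Hypothesis br : forall x, linear (b x).

Let b0 y : b 0 y = 0.
Proof.
by have := bl y (-1) 0 0; rewrite scaleN1r oppr0 addr0 scaleN1r addNr.
Qed.
Let b0r x : b x 0 = 0.
Proof.
by have := br x (-1) 0 0; rewrite scaleN1r oppr0 addr0 scaleN1r addNr.
Qed.

Let lift_rel u v : tensor_rel u v ->
  \sum_(p <- u) b p.1 p.2 = \sum_(p <- v) b p.1 p.2.
Proof.
elim=> {u v} [//|//|u v w _ -> _ -> //|u v uv|u v w _ IH|y|x x' y|x y y'|a x y].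
- exact: perm_big.
- by rewrite !big_cat/= IH.
- by rewrite big_seq1 big_nil/= b0.
- rewrite big_seq1 !big_cons big_nil/= addr0.
  by have := bl y 1 x x'; rewrite !scale1r.
- rewrite big_seq1 !big_cons big_nil/= addr0.
  by have := br x 1 y y'; rewrite !scale1r.
- rewrite !big_seq1/=.
  have := bl y a x 0; have := br x a y 0.
  by rewrite !addr0 b0 b0r !addr0 => -> ->.
Qed.

Lemma tensor_lift_pi u :
  tensor_lift b (\pi_tensor u) = \sum_(p <- u) b p.1 p.2.
Proof. exact/lift_rel/tensor_reprP. Qed.

Lemma tensor_lift_tens x y : tensor_lift b (tens x y) = b x y.
Proof. by rewrite tensor_lift_pi big_seq1. Qed.

Lemma tensor_liftD u v :
  tensor_lift b (u + v) = tensor_lift b u + tensor_lift b v.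
Proof.
elim/quotW: u => u; elim/quotW: v => v; rewrite -pi_cat.
by rewrite (tensor_lift_pi (u ++ v)) !tensor_lift_pi big_cat.
Qed.

Lemma tensor_liftZ a u : tensor_lift b (a *: u) = a *: tensor_lift b u.
Proof.
elim/quotW: u => u; rewrite -pi_scale.
rewrite (tensor_lift_pi (scl a u)) tensor_lift_pi big_map scaler_sumr; apply: eq_bigr => -[x y] _ /=.
by have := bl y a x 0; rewrite !addr0 b0 addr0.
Qed.

End Lift.

End Tensor.

Record seminorm {R : realType} (E : lmodType R) := Seminorm {
  seminorm_fun :> E -> R ;
  seminormD : forall x y, seminorm_fun (x + y) <= seminorm_fun x + seminorm_fun y ;
  seminormZ : forall a x, seminorm_fun (a *: x) = `|a| * seminorm_fun x }.

Definition unit_sphere {R : realType} (V : normedModType R) : set V :=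
  [set v | `|v| = 1].
Arguments unit_sphere {R} V.

Section InjectiveNorm.
Context {R : realType} (X Y : normedModType R).

(* On the class of [\sum_i x_i (x) y_i] this is [\sum_i f x_i * g y_i], by
   [tensor_lift_pi] *)
Definition tensor_pairing (f : dual X) (g : dual Y) (u : tensor X Y) : R :=
  tensor_lift (fun x y => f x * g y : R^o) u.

(* [sup set0 = 0], which is the convention needed when [X] or [Y] is zero. *)
Definition inj_norm (u : tensor X Y) : R :=
  sup [set `|tensor_pairing f g u|
      | f in unit_sphere (dual X) & g in unit_sphere (dual Y)].

Section Pairing.
Variables (f : dual X) (g : dual Y).

Let pl y : linear (fun x => f x * g y : R^o).
Proof. by move=> a x x'; rewrite linearP mulrDl -scalerAl. Qed.
Let pr x : linear (fun y => f x * g y : R^o).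
Proof. by move=> a y y'; rewrite linearP mulrDr -scalerAr. Qed.

Lemma tensor_pairing_pi u : tensor_pairing f g (\pi_(tensor X Y)%qT u) =
  \sum_(p <- u) f p.1 * g p.2.
Proof. exact: (tensor_lift_pi pl pr). Qed.

Lemma tensor_pairingD u v :
  tensor_pairing f g (u + v) = tensor_pairing f g u + tensor_pairing f g v.
Proof. exact: (tensor_liftD pl pr). Qed.

Lemma tensor_pairingZ a u :
  tensor_pairing f g (a *: u) = a * tensor_pairing f g u.
Proof. exact: (tensor_liftZ pl pr). Qed.

End Pairing.

Let has_ub u : has_ubound [set `|tensor_pairing f g u|
      | f in unit_sphere (dual X) & g in unit_sphere (dual Y)].
Proof.
exists (\sum_(p <- repr u) `|p.1| * `|p.2|) => _ [f /= f1 [g /= g1 <-]].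
rewrite -[u in tensor_pairing _ _ u]reprK tensor_pairing_pi.
rewrite (le_trans (ler_norm_sum _ _ _))//; apply: ler_sum => -[x y] _ /=.
rewrite normrM ler_pM//.
  by have := dual_norm_le f x; rewrite f1 mul1r.
by have := dual_norm_le g y; rewrite g1 mul1r.
Qed.

Lemma inj_norm_ub f g u : `|f| = 1 -> `|g| = 1 ->
  `|tensor_pairing f g u| <= inj_norm u.
Proof. by move=> f1 g1; apply: ub_le_sup; [exact: has_ub|exists f => //; exists g]. Qed.

Lemma inj_norm_lub u C : 0 <= C -> (forall f g, `|f| = 1 -> `|g| = 1 ->
  `|tensor_pairing f g u| <= C) -> inj_norm u <= C.
Proof.
move=> C0 uC; rewrite /inj_norm.
have [->|/set0P ne] := eqVneq [set `|tensor_pairing f g u|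
  | f in unit_sphere (dual X) & g in unit_sphere (dual Y)] set0.
  by rewrite sup0.
by apply: ge_sup => // _ [f /= f1 [g /= g1 <-]]; exact: uC.
Qed.

Lemma inj_norm_ge0 u : 0 <= inj_norm u.
Proof.
have [e|/set0P[_ [f f1 [g g1 _]]]] := eqVneq [set `|tensor_pairing f g u|
  | f in unit_sphere (dual X) & g in unit_sphere (dual Y)] set0.
  by rewrite /inj_norm e sup0.
exact: le_trans (inj_norm_ub u f1 g1).
Qed.

Lemma inj_normD u v : inj_norm (u + v) <= inj_norm u + inj_norm v.
Proof.
apply: inj_norm_lub => [|f g f1 g1]; first by rewrite addr_ge0 ?inj_norm_ge0.
by rewrite tensor_pairingD (le_trans (ler_normD _ _))// lerD// inj_norm_ub.
Qed.

Lemma inj_normZ a u : inj_norm (a *: u) = `|a| * inj_norm u.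
Proof.
have le b v : inj_norm (b *: v) <= `|b| * inj_norm v.
  apply: inj_norm_lub => [|f g f1 g1]; first by rewrite mulr_ge0 ?inj_norm_ge0.
  by rewrite tensor_pairingZ normrM ler_wpM2l// inj_norm_ub.
apply/eqP; rewrite eq_le le/=.
have [->|a0] := eqVneq a 0; first by rewrite normr0 mul0r inj_norm_ge0.
rewrite -ler_pdivlMl ?normr_gt0// -normfV.
by rewrite -{1}[u](scale1r u) -(mulVf a0) -scalerA le.
Qed.

Definition inj_seminorm : seminorm (tensor X Y) :=
  Seminorm inj_normD inj_normZ.

End InjectiveNorm.

Section CauchySeq.
Context {R : realType} {E : lmodType R} (p : seminorm E).

Definition cauchy_for : {pred nat -> E} := fun u => `[< forall e : R, 0 < e ->
  exists N, forall m n, (N <= m)%N -> (N <= n)%N -> p (u m - u n) < e >].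

Record cauchy_seq :=
  CauchySeq {cauchy_fun :> nat -> E ; cauchy_funP : cauchy_fun \in cauchy_for}.

HB.instance Definition _ := [isSub for cauchy_fun].
HB.instance Definition _ := [Choice of cauchy_seq by <:].

Lemma seminorm0 : p 0 = 0.
Proof. by rewrite -(scale0r 0) seminormZ normr0 mul0r. Qed.

Lemma seminormN x : p (- x) = p x.
Proof. by rewrite -scaleN1r seminormZ normrN normr1 mul1r. Qed.

Lemma seminormB x y : p (x - y) = p (y - x).
Proof. by rewrite -opprB seminormN. Qed.

Lemma seminorm_ge0 x : 0 <= p x.
Proof.
have := seminormD p x (- x); rewrite subrr seminorm0 seminormN -mulr2n.
by rewrite pmulrn_lge0.
Qed.

Lemma seminorm_dist x y : `|p x - p y| <= p (x - y).
Proof.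
have h a b : p a - p b <= p (a - b).
  by rewrite lerBlDr -{1}(subrK b a) seminormD.
by rewrite ler_norml h andbT lerNl opprB seminormB h.
Qed.

Lemma cauchy_forP (u : nat -> E) : reflect (forall e : R, 0 < e ->
  exists N, forall m n, (N <= m)%N -> (N <= n)%N -> p (u m - u n) < e)
  (u \in cauchy_for).
Proof. exact: asboolP. Qed.

Lemma cauchy_for_submod_closed : submod_closed cauchy_for.
Proof.
split.
  apply/cauchy_forP => e e0; exists 0%N => m n _ _.
  by rewrite -[X in p X]/(0 - 0 : E) subr0 seminorm0.
move=> a u v /cauchy_forP uc /cauchy_forP vc; apply/cauchy_forP => e e0.
have e20 : 0 < e / 2 by rewrite divr_gt0.
have a0 : 0 < `|a| + 1 by rewrite ltr_pwDr.
have [N Nu] := uc _ (divr_gt0 e20 a0); have [M Mv] := vc _ e20.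
exists (maxn N M) => m n; rewrite !geq_max => /andP[Nm Mm] /andP[Nn Mn].
rewrite -[X in p X]/(a *: u m + v m - (a *: u n + v n)).
rewrite opprD addrACA -scalerBr (le_lt_trans (seminormD _ _ _))//.
rewrite [e]splitr ler_ltD ?Mv// seminormZ.
rewrite (@le_trans _ _ ((`|a| + 1) * p (u m - u n)))//.
  by rewrite ler_wpM2r ?seminorm_ge0// lerDl.
by rewrite -ler_pdivlMl// mulrC ltW// Nu.
Qed.

HB.instance Definition _ :=
  GRing.isSubmodClosed.Build R (nat -> E) cauchy_for cauchy_for_submod_closed.
HB.instance Definition _ := [SubChoice_isSubLmodule of cauchy_seq by <:].

Definition null_seq : {pred cauchy_seq} :=
  fun u => `[< p (u n) @[n --> \oo] --> (0 : R) >].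

Lemma null_seqP (u : cauchy_seq) :
  reflect (p (u n) @[n --> \oo] --> (0 : R)) (u \in null_seq).
Proof. exact: asboolP. Qed.

Lemma null_seq_submod_closed : submod_closed null_seq.
Proof.
split.
  by apply/null_seqP; under eq_fun do rewrite /= seminorm0; exact: cvg_cst.
move=> a u v /null_seqP u0 /null_seqP v0; apply/null_seqP.
apply: (@squeeze_cvgr _ _ _ _ (fun=> 0) (fun n => `|a| * p (u n) + p (v n))).
- near=> n; rewrite seminorm_ge0/=.
  by rewrite -[X in p X]/(a *: u n + v n) -seminormZ seminormD.
- exact: cvg_cst.
- by rewrite -[X in _ --> X]addr0 -[X in X + 0](mulr0 `|a|); apply: cvgD => //; exact: cvgMr.
Unshelve. all: by end_near. Qed.

HB.instance Definition _ :=
  GRing.isSubmodClosed.Build R cauchy_seq null_seq null_seq_submod_closed.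

Lemma cauchy_cvg_seminorm (u : cauchy_seq) : cvgn (fun n => p (u n)).
Proof.
apply: cauchy_cvg; apply: cauchy_exP => e e0.
have /cauchy_forP/(_ _ e0)[N Nu] := cauchy_funP u.
exists (p (u N)); exists N => //= n /= Nn.
by rewrite /ball/= (le_lt_trans (seminorm_dist _ _))// Nu.
Qed.

End CauchySeq.
Arguments null_seq {R E} p.

Section Completion.
Context {R : realType} {E : lmodType R} (p : seminorm E).

Local Open Scope quotient_scope.

(* Cauchy sequences modulo null sequences.  Definiteness of [p] is not needed:
   it only makes [to_completion] injective.  [inj_norm] is in fact definite, by
   the Hahn-Banach theorem. *)
Definition completion : Type := Quotient.quot (null_seq p).
HB.instance Definition _ := GRing.Zmodule.on completion.
HB.instance Definition _ := EqQuotient.on completion.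

Lemma completionP (u v : cauchy_seq p) :
  (\pi_completion u = \pi_completion v) <-> u - v \in null_seq p.
Proof.
by rewrite Quotient.idealrBE; split=> [->|/eqP].
Qed.

Lemma completion_pi_add (u v : cauchy_seq p) :
  \pi_completion (u + v) = \pi_completion u + \pi_completion v.
Proof. exact: Quotient.pi_add. Qed.

Let cscale (a : R) (u : completion) : completion := \pi_completion (a *: repr u).

Let cscaleE a u : cscale a (\pi_completion u) = \pi_completion (a *: u).
Proof.
apply/completionP; rewrite -scalerBr rpredZ//.
by apply/completionP; rewrite reprK.
Qed.

Let cscaleA a b u : cscale a (cscale b u) = cscale (a * b) u.
Proof. by elim/quotW: u => u; rewrite (cscaleE b u) (cscaleE a) (cscaleE (a * b)) scalerA. Qed.

Let cscale1 : left_id 1 cscale.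
Proof. by elim/quotW=> u; rewrite cscaleE scale1r. Qed.

Let cscaleDr : right_distributive cscale +%R.
Proof.
move=> a; elim/quotW=> u; elim/quotW=> v.
rewrite -completion_pi_add (cscaleE a (u + v)) (cscaleE a u) (cscaleE a v).
by rewrite scalerDr completion_pi_add.
Qed.

Let cscaleDl u : {morph cscale^~ u : a b / a + b}.
Proof.
elim/quotW: u => u a b; rewrite (cscaleE (a + b)) (cscaleE a) (cscaleE b).
by rewrite scalerDl completion_pi_add.
Qed.

HB.instance Definition _ := GRing.Zmodule_isLmodule.Build R completion
  cscaleA cscale1 cscaleDr cscaleDl.

Lemma completion_pi_scale a (u : cauchy_seq p) :
  \pi_completion (a *: u) = a *: \pi_completion u.
Proof. exact/esym/cscaleE. Qed.

Definition completion_norm (x : completion) : R :=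
  limn (fun n => p ((repr x : cauchy_seq p) n)).

Lemma completion_norm_cvg (u : cauchy_seq p) :
  p (u n) @[n --> \oo] --> completion_norm (\pi_completion u).
Proof.
set v : cauchy_seq p := repr (\pi_completion u).
have /completionP/null_seqP vu0 : \pi_completion v = \pi_completion u.
  by rewrite reprK.
have vl : p (v n) @[n --> \oo] --> completion_norm (\pi_completion u).
  exact: cauchy_cvg_seminorm.
suff d0 : p (u n) - p (v n) @[n --> \oo] --> (0 : R).
  rewrite -[completion_norm _]add0r.
  rewrite (_ : (fun n => p (u n)) = (fun n => p (u n) - p (v n) + p (v n))).
    exact: cvgD.
  by apply/funext => n; rewrite subrK.
apply: norm_cvg0.
apply: (@squeeze_cvgr _ _ _ _ (fun=> 0) (fun n => p (v n - u n))) => //.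
  by near=> n; rewrite normr_ge0/= seminormB seminorm_dist.
exact: cvg_cst.
Unshelve. all: by end_near. Qed.

Lemma completion_norm_pi (u : cauchy_seq p) (l : R) :
  p (u n) @[n --> \oo] --> l -> completion_norm (\pi_completion u) = l.
Proof.
move=> ul; rewrite -(cvg_lim (@Rhausdorff R) ul).
exact/esym/(cvg_lim (@Rhausdorff R))/completion_norm_cvg.
Qed.

Let cnormD x y :
  completion_norm (x + y) <= completion_norm x + completion_norm y.
Proof.
elim/quotW: x => u; elim/quotW: y => v; rewrite -completion_pi_add.
have uvl : p (u n) + p (v n) @[n --> \oo] -->
    completion_norm (\pi_completion u) + completion_norm (\pi_completion v).
  by apply: cvgD; exact: completion_norm_cvg.
apply: (ler_cvg_to (@completion_norm_cvg (u + v)) uvl).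
by near=> n; exact: seminormD.
Unshelve. all: by end_near. Qed.

Let cnormZ a x : completion_norm (a *: x) = `|a| * completion_norm x.
Proof.
elim/quotW: x => u; rewrite -completion_pi_scale.
apply: completion_norm_pi; under eq_fun do rewrite /= seminormZ.
by apply: cvgMr; exact: completion_norm_cvg.
Qed.

Let cnorm_eq0 x : completion_norm x = 0 -> x = 0.
Proof.
elim/quotW: x => u u0.
rewrite -[RHS]reprK; apply/completionP; rewrite rpredB//.
  by apply/null_seqP; rewrite -[X in _ --> X]u0; exact: completion_norm_cvg.
rewrite -[X in X \in _]subr0; apply/completionP; rewrite reprK.
by have := completion_pi_scale 0 0; rewrite !scale0r.
Qed.

HB.instance Definition _ :=
  @Lmodule_isNormed.Build R completion completion_norm cnormD cnormZ cnorm_eq0.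

Lemma completion_normE (x : completion) : `|x| = completion_norm x.
Proof. by []. Qed.

Lemma cst_cauchy (x : E) : (fun=> x) \in cauchy_for p.
Proof.
by apply/cauchy_forP => e e0; exists 0%N => m n _ _; rewrite subrr seminorm0.
Qed.

Definition to_completion (x : E) : completion :=
  \pi_completion (CauchySeq (cst_cauchy x)).

Lemma to_completion_linear : linear to_completion.
Proof.
move=> a x y; rewrite /to_completion -completion_pi_scale -completion_pi_add.
by congr (\pi_completion _); exact: val_inj.
Qed.

HB.instance Definition _ :=
  GRing.isLinear.Build R E completion _ to_completion to_completion_linear.

Lemma to_completion_norm x : `|to_completion x| = p x.
Proof.
rewrite completion_normE.
by apply: (@completion_norm_pi (CauchySeq (cst_cauchy x))) => /=; apply: cvg_cst.
Qed.

Lemma to_completion_cvg (u : cauchy_seq p) (e : R) : 0 < e ->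
  exists N, forall n, (N <= n)%N -> `|\pi_completion u - to_completion (u n)| <= e.
Proof.
move=> e0; have /cauchy_forP/(_ _ e0)[N Nu] := cauchy_funP u.
exists N => n Nn; pose d : cauchy_seq p := u - CauchySeq (cst_cauchy (u n)).
have -> : \pi_completion u - to_completion (u n) = \pi_completion d.
  apply: (addIr (to_completion (u n))).
  by rewrite subrK /to_completion -completion_pi_add subrK.
rewrite completion_normE.
apply: (ler_cvg_to (@completion_norm_cvg d) (cvg_cst e)).
near=> m; apply/ltW/Nu => //; near: m; exact: nbhs_infty_ge.
Unshelve. all: by end_near. Qed.

Lemma to_completion_dense (x : completion) (e : R) : 0 < e ->
  exists y, `|x - to_completion y| < e.
Proof.
elim/quotW: x => u e0.
have [N Nu] := to_completion_cvg u (divr_gt0 e0 (ltr0Sn R 1)).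
exists (u N); rewrite (le_lt_trans (Nu _ (leqnn N)))//.
by rewrite ltr_pdivrMr// ltr_pMr// ltr1n.
Qed.

Let inv_small (e : R) : 0 < e ->
  exists N, forall n, (N <= n)%N -> n.+1%:R^-1 < e.
Proof.
move=> e0; exists (Num.bound e^-1) => n Nn.
rewrite -[e]invrK ltf_pV2 ?posrE ?invr_gt0//.
have e1 : 0 <= e^-1 by rewrite invr_ge0 ltW.
by apply: lt_le_trans (archi_boundP e1) _; rewrite ler_nat leqW.
Qed.

Lemma completion_complete (F : set_system completion) :
  ProperFilter F -> cauchy F -> cvg F.
Proof.
move=> FF /cauchyP Fc.
have h n : {y : E | F [set x | `|x - to_completion y| < n.+1%:R^-1]}.
  apply: cid; have n0 : 0 < n.+1%:R^-1 / 2 :> R by rewrite divr_gt0 ?invr_gt0.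
  have [x Fx] := Fc _ n0; have [y xy] := to_completion_dense x n0.
  exists y; apply: filterS Fx => z; rewrite -ball_normE/= => xz.
  rewrite (le_lt_trans (ler_distD x _ _))// [ltRHS]splitr ltrD//.
  by rewrite distrC.
pose u n := sval (h n).
have uF n : F [set x | `|x - to_completion (u n)| < n.+1%:R^-1].
  exact: svalP (h n).
have uc : u \in cauchy_for p.
  apply/cauchy_forP => e e0.
  have e20 : 0 < e / 2 by rewrite divr_gt0.
  have [N Ne] := inv_small e20; exists N => m n Nm Nn.
  have [x /= [xm xn]] := filter_ex (filterI (uF m) (uF n)).
  rewrite -to_completion_norm linearB (le_lt_trans (ler_distD x _ _))//.
  rewrite [ltRHS]splitr distrC ltrD//.
    exact: lt_trans xm (Ne _ Nm).
  exact: lt_trans xn (Ne _ Nn).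
apply/cvg_ex; exists (\pi_completion (CauchySeq uc)).
apply/cvgrPdist_lt => e e0; have e20 : 0 < e / 2 by rewrite divr_gt0.
have [N Ne] := inv_small e20.
have [M Mu] := to_completion_cvg (CauchySeq uc) e20.
pose n := maxn N M; near=> x.
rewrite (le_lt_trans (ler_distD (to_completion (u n)) _ _))//.
rewrite [ltRHS]splitr ler_ltD//.
  by apply: Mu; exact: leq_maxr.
rewrite distrC (@lt_trans _ _ n.+1%:R^-1)//; last exact/Ne/leq_maxl.
by near: x; exact: uF.
Unshelve. all: by end_near. Qed.

HB.instance Definition _ :=
  Uniform_isComplete.Build completion completion_complete.

End Completion.

Definition injective_tensor {R : realType} (X Y : normedModType R) :
    completeNormedModType R := completion (inj_seminorm X Y).

(* Main.v *)
From HB Require Import structures.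
Require Import Defs.
From mathcomp Require Import all_boot all_order all_algebra.
From mathcomp Require Import all_classical all_reals all_analysis.
From mathcomp Require Import perm ring lra zify.

(** If [X] has a basis [e_1, .., e_n], then [u |-> ((e_i^* (x) id) u)_i] embeds
    the injective tensor product in [Y^n], so one has to see that
    superreflexivity passes from [Y] to every space [V] that embeds in a finite
    power of [Y] ([superreflexive_embed]).  Let [W] be finitely representable
    in [V], by almost isometric maps [T_s] defined on the span of each finite
    list [s] of vectors.  Along an ultrafilter on the lists, the norms of the
    coordinates of [T_s w] converge to seminorms [p_1, .., p_n] of [W] whose sum
    is equivalent to the norm.  Such a limit seminorm is, on each
    finite-dimensional subspace, nearly equal to one of the norms that converge
    to it; hence its completion is finitely representable in [Y]
    ([ultra_completion_finitely_representable]) and is reflexive.  As [W] is a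
    closed subspace of the product of these completions, it is reflexive
    ([reflexive_joint]).  The case of a finite-dimensional [Y] follows by
    exchanging the factors.

    Conversely, let [X] and [Y] be infinite-dimensional.  The Dvoretzky-Rogers
    lemma gives, for each [N], vectors [x_1, .., x_N] of norm at least 1/8 in
    [X] for which the map [c |-> \sum_i c_i x_i] has norm at most 1 on Euclidean
    space, and similarly [y_1, .., y_N] in [Y].  By the Cauchy-Schwarz
    inequality the injective norm of [\sum_i c_i (x_i (x) y_i)] is then at most
    [max_i |c_i|], and on a suitable subset of the indices it is also at least
    [max_i |c_i| / 128] ([injective_tensor_sup_norm]).  An ultrafilter limit of
    these finite sequences is a seminorm on finitely supported sequences that
    is equivalent to the supremum norm; its completion is isomorphic to c_0,
    which is not reflexive, and it is finitely representable in the tensor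
    product ([injective_tensor_not_superreflexive]). *)

Set Implicit Arguments.
Unset Strict Implicit.
Unset Printing Implicit Defensive.

Import Order.TTheory GRing.Theory Num.Theory.
Import numFieldNormedType.Exports.

Local Open Scope classical_set_scope.
Local Open Scope ring_scope.

(** * The Hahn-Banach theorem *)

Section HahnBanach.
Context {R : realType} {L : lmodType R}.

Definition sublinear (q : L -> R) :=
  (forall x y, q (x + y) <= q x + q y) /\
  (forall a x, 0 <= a -> q (a *: x) <= a * q x).

Lemma sublinear0 q : sublinear q -> q 0 = 0.
Proof.
move=> [qD qZ]; have := qD 0 0; have := qZ 0 0 (lexx 0).
by rewrite scale0r mul0r addr0; lra.
Qed.

Lemma sublinear_ge q x : sublinear q -> - q (- x) <= q x.
Proof.
move=> sq; have [qD _] := sq; have := qD x (- x).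
by rewrite subrr (sublinear0 sq); lra.
Qed.

(** The infimum over [k] of [q (x - j k) + g k] is the greatest sublinear
    functional below [q] that is at most [g k] at each [j k].  The cone [P] is a
    half-line when a single value is lowered, and a whole space when a
    functional is extended. *)
Lemma sublinear_infconv (K : lmodType R) (P : set K) (j : {linear K -> L})
    (g : {linear K -> R^o}) q : sublinear q -> P 0 ->
  (forall k l, P k -> P l -> P (k + l)) ->
  (forall a k, 0 <= a -> P k -> P (a *: k)) ->
  (forall k, P k -> 0 <= q (- j k) + g k) ->
  exists2 r, sublinear r & forall x k, P k -> r x <= q (x - j k) + g k.
Proof.
move=> sq P0 PD PZ qg; have [qD qZ] := sq.
pose S x := [set q (x - j k) + g k | k in P].
have lbS x : lbound (S x) (- q (- x)).
  move=> _ [k Pk <-]; have := qD (x - j k) (- x); have := qg _ Pk.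
  by rewrite addrAC subrr add0r; lra.
have infS x k : P k -> inf (S x) <= q (x - j k) + g k.
  by move=> Pk; apply: ge_inf; [exists (- q (- x))|exists k].
have S0 x : S x !=set0 by exists (q (x - j 0) + g 0), 0.
exists (fun x => inf (S x)) => //; split=> [x y|a x].
  rewrite /= -lerBlDr; apply: lb_le_inf => // _ [k Pk <-].
  rewrite lerBlDr -lerBlDl; apply: lb_le_inf => // _ [l Pl <-].
  have := infS (x + y) _ (PD _ _ Pk Pl); have := qD (x - j k) (y - j l).
  rewrite (linearD j) (linearD g) /= opprD.
  rewrite addrACA.
  by set u := inf _; lra.
rewrite le_eqVlt => /predU1P[<-|a0].
  have := infS 0 0 P0; rewrite (linear0 j) (linear0 g) subr0 (sublinear0 sq).
  rewrite scale0r mul0r.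
  by rewrite addr0.
rewrite /= mulrC -ler_pdivrMr//; apply: lb_le_inf => // _ [k Pk <-].
rewrite ler_pdivrMr//; have := infS (a *: x) _ (PZ _ _ (ltW a0) Pk).
have := qZ a (x - j k) (ltW a0).
rewrite (linearZZ j) (linearZZ g) /= -[a *: g k]/(a * g k) scalerBr.
by set u := inf _; lra.
Qed.

(** A minimal sublinear functional is linear: replacing [r x] by the infimum
    over [t >= 0] of [r (x + t v) - t (r v)] cannot make it smaller. *)
Lemma sublinear_ge_linear q : sublinear q ->
  exists2 G : L -> R^o, linear G & forall x, G x <= q x.
Proof.
move=> sq.
pose below (r : L -> R) := sublinear r /\ forall x, r x <= q x.
pose T := {r : L -> R | below r}.
pose le (r s : T) := `[< forall x, sval s x <= sval r x >].
have [||||r rmin] := @Zorn T le.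
- by move=> r; apply/asboolP.
- move=> r s t /asboolP rs /asboolP st; apply/asboolP => x.
  exact: le_trans (st x) (rs x).
- move=> [r pr] [s ps] /asboolP/= rs /asboolP/= sr; apply/eq_exist.
  by apply/funext => x; apply/eqP; rewrite eq_le sr rs.
- move=> A Atot; have [[r0 Ar0]|A0] := pselect (A !=set0); last first.
    have qq : below q by [].
    by exists (exist below q qq) => s As; case: A0; exists s.
  pose S x := [set sval r x | r in A].
  have lbS x : lbound (S x) (- q (- x)).
    move=> _ [r Ar <-]; have [sr rq] := svalP r.
    by have := sublinear_ge x sr; have := rq (- x); lra.
  have infS x r : A r -> inf (S x) <= sval r x.
    by move=> Ar; apply: ge_inf; [exists (- q (- x))|exists r].
  have S0 x : S x !=set0 by exists (sval r0 x), r0.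
  suff pS : below (fun x => inf (S x)).
    by exists (exist below _ pS) => s As; apply/asboolP => x; exact: infS.
  split; last first.
    by move=> x; apply: le_trans (infS x _ Ar0) _; have [] := svalP r0.
  split=> [x y|a x].
    rewrite /= -lerBlDr; apply: lb_le_inf => // _ [r Ar <-].
    rewrite lerBlDr -lerBlDl; apply: lb_le_inf => // _ [s As <-].
    wlog rs : x y r s Ar As / forall z, sval r z <= sval s z => [wl|].
      case: (Atot _ _ Ar As) => /asboolP h; last exact: (wl x y r s).
      by have := wl y x s r As Ar h; rewrite (addrC y); set u := inf _; lra.
    have [[sr _] _] := svalP r; have := sr x y; have := rs y.
    by have := infS (x + y) _ Ar; set u := inf _; lra.
  rewrite le_eqVlt => /predU1P[<-|a0].
    have [sr _] := svalP r0.
    by have := infS 0 _ Ar0; rewrite (sublinear0 sr) scale0r mul0r.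
  rewrite /= mulrC -ler_pdivrMr//; apply: lb_le_inf => // _ [r Ar <-].
  rewrite ler_pdivrMr//; have [[_ sr] _] := svalP r.
  by rewrite mulrC; apply: le_trans (infS _ _ Ar) (sr _ _ (ltW a0)).
have [sr rq] := svalP r; have [rD rZ] := sr.
have rD' x v : sval r (x + v) = sval r x + sval r v.
  apply/eqP; rewrite eq_le rD/=.
  pose j : R^o -> L := fun t => - (t *: v).
  pose g : R^o -> R^o := fun t => - (t * sval r v).
  have jl : linear j.
    by move=> a s t; rewrite /j scalerDl opprD scalerN -scalerA.
  have gl : linear g.
    move=> a s t; rewrite /g mulrDl opprD -[a *: - _]/(a * - _) mulrN.
    by rewrite -[a *: s]/(a * s) mulrA.
  pose J : {linear R^o -> L} := HB.pack j (GRing.isLinear.Build _ _ _ _ j jl).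
  pose G : {linear R^o -> R^o} := HB.pack g (GRing.isLinear.Build _ _ _ _ g gl).
  have [|||k k0|r' sr' r'E] := @sublinear_infconv R^o [set t | 0 <= t] J G _ sr.
  - exact: lexx.
  - by move=> k l /= k0 l0; rewrite addr_ge0.
  - by move=> a k a0 /= k0; rewrite mulr_ge0.
  - rewrite /= /j /g opprK subr_ge0.
    have [->|kn0] := eqVneq k 0; first by rewrite scale0r (sublinear0 sr) mul0r.
    have kp : 0 < k by rewrite lt_def kn0.
    rewrite -ler_pdivlMl// -[v in leLHS]scale1r -(mulVf kn0) -scalerA.
    by apply: rZ; rewrite invr_ge0 ltW.
  have r'r x' : r' x' <= sval r x'.
    by have := r'E x' 0 (lexx 0); rewrite raddf0 subr0 raddf0 addr0.
  have pr' : below r'.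
    by split=> // x'; apply: le_trans (r'r x') (rq x').
  have e : r' = sval r.
    pose s : T := exist below r' pr'.
    by rewrite -(rmin s)//; apply/asboolP.
  have {r'E} := r'E x 1 ler01; rewrite e /= /j /g.
  by rewrite opprK scale1r mul1r; lra.
have rN x : sval r (- x) = - sval r x.
  by have := rD' x (- x); rewrite subrr (sublinear0 sr); lra.
have rZ' a x : 0 <= a -> sval r (a *: x) = a * sval r x.
  move=> a0; apply/eqP; rewrite eq_le rZ//=.
  by have := rZ a (- x) a0; rewrite scalerN !rN mulrN lerN2.
exists (sval r) => // a x y; rewrite rD'; congr (_ + _).
have [a0|a0] := leP 0 a; first exact: rZ'.
rewrite -[a]opprK scaleNr rN rZ' ?oppr_ge0 1?ltW//.
by rewrite -[RHS]/(_ * _) -mulNr.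
Qed.

(** The subspace is given as the image of [j], with [g] defined on the source
    of [j]: this stands for a partial function, as [g] is constant on the fibres
    of [j] because it is dominated by [q \o j].  A linear functional below the
    infimum of [q (x - j k) + g k] extends [g]. *)
Lemma hahn_banach (K : lmodType R) (j : {linear K -> L})
    (g : {linear K -> R^o}) (q : seminorm L) :
  (forall k, g k <= q (j k)) ->
  exists2 G : L -> R^o, linear G &
    (forall k, G (j k) = g k) /\ (forall x, `|G x| <= q x).
Proof.
move=> gq.
have sq : sublinear q.
  split=> [x y|a x a0]; first exact: seminormD.
  by rewrite seminormZ ger0_norm.
have [//|//|//|k _|r sr rE] := @sublinear_infconv K setT j g _ sq.
  by have := gq (- k); rewrite !linearN /=; lra.
have [G Gl Gr] := sublinear_ge_linear sr.
pose G' : {linear L -> R^o} := HB.pack G (GRing.isLinear.Build _ _ _ _ G Gl).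
have Gq x : G x <= q x.
  by have := le_trans (Gr x) (rE x 0 I); rewrite raddf0 subr0 raddf0 addr0.
have GN x : G (- x) = - G x by exact: (linearN G').
exists G => //; split=> [k|x]; last first.
  by rewrite ler_norml Gq andbT lerNl -GN -(seminormN q) Gq.
have h l : G (j l) <= g l.
  have := le_trans (Gr (j l)) (rE _ l I).
  by rewrite subrr (sublinear0 sq) add0r.
apply/eqP; rewrite eq_le h/=.
by have := h (- k); rewrite !linearN /= GN lerN2.
Qed.

Lemma norming_functional (q : seminorm L) v :
  exists2 G : L -> R^o, linear G & G v = q v /\ (forall x, `|G x| <= q x).
Proof.
have jl : linear (fun t : R^o => t *: v) by move=> a s t; rewrite scalerDl -scalerA.
have gl : linear (fun t : R^o => t * q v : R^o).
  by move=> a s t; rewrite mulrDl -[a *: _ in RHS]/(a * _) mulrA.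
pose J : {linear R^o -> L} := HB.pack (fun t : R^o => t *: v)
  (GRing.isLinear.Build _ _ _ _ _ jl).
pose g : {linear R^o -> R^o} := HB.pack (fun t : R^o => t * q v : R^o)
  (GRing.isLinear.Build _ _ _ _ _ gl).
have [t|G Gl [Ge Gq]] := @hahn_banach R^o J g q.
  by rewrite /= seminormZ ler_wpM2r ?seminorm_ge0// ler_norm.
by exists G => //; split=> //; have := Ge 1; rewrite /= scale1r mul1r.
Qed.

End HahnBanach.

(** * Ultrafilter limits and independent families *)

Section UltrafilterLimits.
Context {R : realType} {I : Type} (U : set_system I) {UU : UltraFilter U}.

Definition ulim (f : I -> R) : R := lim (f @ U).

Lemma fmap_ultra (T : Type) (f : I -> T) : UltraFilter (f @ U).
Proof.
split=> [|G GF fG]; first exact: fmap_proper_filter.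
rewrite eqEsubset; split=> // A GA.
have [//|UnA] := @in_ultra_setVsetC I U (f @^-1` A) UU.
have GnA : G (~` A) by apply: fG.
by have [x [Ax nAx]] := filter_ex (filterI GA GnA).
Qed.

Lemma ulim_cvg (f : I -> R) M : (\forall i \near U, `|f i| <= M) ->
  f i @[i --> U] --> ulim f.
Proof.
move=> fM; have fU := fmap_ultra f.
have := @segment_compact R (- M) M; rewrite compact_ultra => /(_ (f @ U) fU).
case=> [|l [_ fl]]; last by apply/cvg_ex; exists l.
by apply: filterS fM => i; rewrite ler_norml /= in_itv.
Qed.

Lemma ulim_eq (f : I -> R) l : f i @[i --> U] --> l -> ulim f = l.
Proof. by move=> fl; apply: (cvg_lim (@Rhausdorff R) fl). Qed.

End UltrafilterLimits.

Lemma cvg_finite_sum {R : realType} (V : normedModType R) (T : Type)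
    (F : set_system T) {FF : Filter F} n (f : 'I_n -> T -> V) (l : 'I_n -> V) :
  (forall i, f i t @[t --> F] --> l i) ->
  \sum_i f i t @[t --> F] --> \sum_i l i.
Proof.
elim: n f l => [|n IH] f l fl.
  by rewrite big_ord0; under eq_fun do rewrite big_ord0; exact: cvg_cst.
rewrite big_ord_recl; under eq_fun do rewrite big_ord_recl.
by apply: cvgD; [exact: fl|apply: IH => i; exact: fl].
Qed.

Section Independence.
Context {R : realType} {V : lmodType R}.

Definition independent n (e : 'I_n -> V) :=
  forall c : 'I_n -> R, \sum_i c i *: e i = 0 -> forall i, c i = 0.

Lemma independent_inj n (e : 'I_n -> V) (c d : 'I_n -> R) : independent e ->
  \sum_i c i *: e i = \sum_i d i *: e i -> c = d.
Proof.
move=> ie cd; apply/funext => i; apply/eqP; rewrite -subr_eq0; apply/eqP.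
apply: (ie (fun i => c i - d i)).
by under eq_bigr do rewrite scalerBl; rewrite sumrB cd subrr.
Qed.

(** Outside the span of the family the coordinates are arbitrary. *)
Lemma coordinates n (e : 'I_n -> V) : independent e ->
  exists k : V -> 'I_n -> R, forall c, k (\sum_i c i *: e i) = c.
Proof.
move=> ie.
have h v : exists c : 'I_n -> R,
    forall d, v = \sum_i d i *: e i -> c = d.
  have [[c ->]|nv] := pselect (exists c : 'I_n -> R, v = \sum_i c i *: e i).
    by exists c => d; exact: independent_inj.
  by exists (fun=> 0) => d vd; case: nv; exists d.
by have [k kP] := choice h; exists k => c; exact: kP.
Qed.

(** A spanning family of least length is independent. *)
Lemma fin_dim_basis (E : set V) : fin_dim_subspace E ->
  exists n (e : 'I_n -> V), independent e /\
    E = range (fun c : 'I_n -> R => \sum_i c i *: e i).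
Proof.
move=> Efd.
pose P n := `[< exists e : 'I_n -> V,
  E = range (fun c : 'I_n -> R => \sum_i c i *: e i) >].
have exP : exists n, P n by have [n eE] := Efd; exists n; apply/asboolP.
case: (ex_minnP exP) => n /asboolP[e Ee] nmin; exists n, e; split=> // c c0 k.
apply/eqP/negPn/negP => ck0.
case: n e Ee nmin c c0 k ck0 => [|n] e Ee nmin c c0 k ck0; first by case: k ck0.
suff: P n by move=> /nmin; rewrite ltnn.
apply/asboolP; exists (fun i => e (lift k i)).
have ek : e k = \sum_i (- (c k)^-1 * c (lift k i)) *: e (lift k i).
  move: c0; rewrite (bigD1_ord k)//= => /eqP; rewrite addr_eq0 => /eqP ce.
  rewrite -[LHS]scale1r -(mulVf ck0) -scalerA ce scalerN -scaleNr scaler_sumr.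
  by apply: eq_bigr => i _; rewrite scalerA.
rewrite Ee eqEsubset; split=> _ [a _ <-]; last first.
  exists (fun i => if unlift k i is Some j then a j else 0) => //.
  rewrite (bigD1_ord k)//= unlift_none scale0r add0r.
  by apply: eq_bigr => i _; rewrite liftK.
exists (fun i => a k * (- (c k)^-1 * c (lift k i)) + a (lift k i)) => //.
rewrite (bigD1_ord k)//= ek scaler_sumr -big_split/=.
by apply: eq_bigr => i _; rewrite scalerA scalerDl.
Qed.

Lemma infinite_dim_independent : ~ finite_dimensional V ->
  forall n, exists e : 'I_n -> V, independent e.
Proof.
move=> nfd; elim=> [|n [e ie]]; first by exists (fun=> 0) => c _ [].
have [v nv] : exists v, ~ range (fun c : 'I_n -> R => \sum_i c i *: e i) v.
  apply/not_existsP => h; apply: nfd; exists n, e.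
  by rewrite eqEsubset; split=> // v _; have /contrapT := h v.
exists (fun i => if unlift ord0 i is Some j then e j else v) => c.
rewrite big_ord_recl unlift_none; under eq_bigr do rewrite liftK.
move=> c0; have c00 : c ord0 = 0.
  apply/eqP/negPn/negP => h; apply: nv.
  exists (fun i => - (c ord0)^-1 * c (lift ord0 i)) => //.
  move/eqP: c0; rewrite addr_eq0 => /eqP c0.
  rewrite -[RHS]scale1r -(mulVf h) -scalerA c0 scalerN -scaleNr scaler_sumr.
  by apply: eq_bigr => i _; rewrite scalerA.
move: c0; rewrite c00 scale0r add0r => c0 i.
case: (unliftP ord0 i) => [j ->|->//].
exact: (ie (fun j => c (lift ord0 j))).
Qed.

End Independence.

Section NormEquivalence.
Context {R : realType} {V : normedModType R}.

Lemma free_ultrafilter : exists2 U : set_system nat, UltraFilter U & \oo `<=` U.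
Proof. by have [U [UU oU]] := ultraFilterLemma (@eventually_filter); exists U. Qed.

Lemma norm_sum_dist n (v : 'I_n -> V) (c d : 'I_n -> R) :
  `| (`|\sum_i c i *: v i|) - (`|\sum_i d i *: v i|) |
  <= \sum_i `|c i - d i| * `|v i|.
Proof.
apply: le_trans (ler_dist_dist _ _) _; rewrite -sumrB.
apply: le_trans (ler_norm_sum _ _ _) _; apply: ler_sum => i _.
by rewrite -scalerBl normrZ.
Qed.

(** Otherwise an ultrafilter limit of normalized coefficients annihilates the
    family. *)
Lemma independent_lower n (e : 'I_n -> V) : independent e ->
  exists2 d : R, 0 < d & forall c, d * \sum_i `|c i| <= `|\sum_i c i *: e i|.
Proof.
move=> ie; apply: contrapT => h.
have hk (k : nat) : exists c : 'I_n -> R, \sum_i `|c i| = 1 /\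
    `|\sum_i c i *: e i| <= k.+1%:R^-1.
  apply: contrapT => hc; apply: h; exists k.+1%:R^-1; first by rewrite invr_gt0.
  move=> c; rewrite leNgt; apply/negP => cl; apply: hc.
  have s0 : 0 < \sum_i `|c i|.
    rewrite lt_def sumr_ge0// andbT; apply/negP => /eqP s0.
    by move: cl; rewrite s0 mulr0 normr_lt0.
  exists (fun i => (\sum_i `|c i|)^-1 * c i); split.
    under eq_bigr do rewrite normrM normfV (gtr0_norm s0).
    by rewrite -mulr_sumr mulVf ?gt_eqF.
  under eq_bigr do rewrite -scalerA.
  rewrite -scaler_sumr normrZ normfV (gtr0_norm s0) ler_pdivrMl//.
  by rewrite mulrC ltW.
have [c cP] := choice hk; have [U UU oU] := free_ultrafilter.
have c1 k i : `|c k i| <= 1.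
  by rewrite -(cP k).1 (bigD1 i)//= lerDl sumr_ge0.
have cl i : c k i @[k --> U] --> ulim U (c^~ i).
  by apply: (@ulim_cvg _ _ _ _ _ 1); exact: nearW.
set l := fun i => ulim U (c^~ i).
have sl : \sum_i `|l i| = 1.
  have h1 : \sum_i `|c k i| @[k --> U] --> \sum_i `|l i|.
    by apply: cvg_finite_sum => i; apply: cvg_norm; exact: cl.
  have h2 : \sum_i `|c k i| @[k --> U] --> (1 : R).
    by under eq_fun do rewrite (cP _).1; exact: cvg_cst.
  exact: (cvg_unique (@Rhausdorff R) h1 h2).
have l0 : \sum_i l i *: e i = 0.
  suff small (t : R) : 0 < t -> `|\sum_i l i *: e i| <= t.
    apply/eqP; rewrite -normr_le0.
    by apply/ler_addgt0Pl => t t0; rewrite addr0 small.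
  move=> t0.
  have h0 : \sum_i `|c k i - l i| * `|e i| @[k --> U] --> (0 : R).
    rewrite [X in _ --> X](_ : _ = \sum_(i < n) `|l i - l i| * `|e i|).
      apply: cvg_finite_sum => i; apply: cvgMl; apply: cvg_norm.
      by apply: cvgB => //; exact: cvg_cst.
    by rewrite big1// => i _; rewrite subrr normr0 mul0r.
  have t20 : 0 < t / 2 by rewrite divr_gt0.
  have n1 : \forall k \near U, \sum_i `|c k i - l i| * `|e i| < t / 2.
    by apply: (cvgr_lt (0 : R)).
  have n2 : \forall k \near U, k.+1%:R^-1 < t / 2.
    by apply: oU; exact: near_infty_natSinv_lt (PosNum t20).
  have [k [k1 k2]] := filter_ex (filterI n1 n2).
  have := norm_sum_dist e (c k) l; rewrite ler_norml => /andP[+ _].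
  move: k1 k2 (cP k).2; set A := `|_|; set B := `|_|; set S := \sum_i _.
  set z : R := k.+1%:R^-1; lra.
have := ie _ l0 => lz; move: sl; rewrite big1 => [/esym/eqP|i _].
  by rewrite oner_eq0.
by rewrite lz normr0.
Qed.

End NormEquivalence.

(** * Functionals on normed spaces and on completions *)

Section BoundedFunctionals.
Context {R : realType}.

Lemma bounded_linear_dual (X : normedModType R) (f : X -> R^o) (C : R) : 0 <= C ->
  linear f -> (forall x, `|f x| <= C * `|x|) ->
  exists2 F : dual X, (forall x, F x = f x) & `|F| <= C.
Proof.
move=> C0 fl fC.
pose f' : {linear X -> R^o} := HB.pack f (GRing.isLinear.Build _ _ _ _ f fl).
have fc : continuous f.
  apply: (@bounded_linear_continuous R X R^o f'); apply/linear_boundedP.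
  near=> M => x; apply: le_trans (fC x) _; apply: ler_wpM2r => //.
have fin : f \in @lincont R X by apply/lincontP.
exists (Dual fin) => //; rewrite dual_normE; apply: ge_sup.
  by exists `|f 0|, 0 => //; split=> //=; rewrite normr0.
move=> _ [x [_ /= x1] <-]; apply: le_trans (fC x) _.
by rewrite -[leRHS]mulr1 ler_wpM2l.
Unshelve. all: by end_near. Qed.

Lemma norming_dual (X : normedModType R) (x : X) : x != 0 ->
  exists2 f : dual X, `|f| = 1 & f x = `|x|.
Proof.
move=> x0.
pose q : seminorm X := Seminorm (@ler_normD _ X) (@normrZ _ X).
have [f fl [fx fq]] := norming_functional q x.
have [|F Ff F1] := bounded_linear_dual ler01 fl.
  by move=> y; rewrite mul1r fq.
exists F; last by rewrite Ff fx.
apply/eqP; rewrite eq_le F1/=.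
have := dual_norm_le F x; rewrite Ff fx [`|q x|]ger0_norm ?normr_ge0//.
by rewrite -{1}[q x]mul1r ler_pM2r// normr_gt0.
Qed.

(** A bounded map sends Cauchy sequences to convergent sequences, and null
    sequences to null sequences. *)
Lemma completion_extend (E : lmodType R) (p : seminorm E)
    (Y : completeNormedModType R) (A : {linear E -> Y}) (C : R) :
  0 <= C -> (forall x, `|A x| <= C * p x) ->
  exists B : completion p -> Y, [/\ linear B,
    (forall x, B (to_completion p x) = A x) & (forall x, `|B x| <= C * `|x|)].
Proof.
move=> C0 AC.
have Acvg (u : cauchy_seq p) : cvgn (fun n => A (u n)).
  apply/cauchy_cvgP; apply: cauchy_exP => t t0.
  have C1 : 0 < C + 1 by rewrite ltr_pwDr.
  have /cauchy_forP/(_ _ (divr_gt0 t0 C1))[N Nu] := cauchy_funP u.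
  exists (A (u N)); exists N => //= n /= Nn.
  rewrite -ball_normE/= -linearB (le_lt_trans (AC _))//.
  apply: (@le_lt_trans _ _ ((C + 1) * p (u N - u n))).
    by rewrite ler_wpM2r ?seminorm_ge0// lerDl.
  by rewrite mulrC -ltr_pdivlMr// Nu.
pose B (x : completion p) : Y := limn (fun n => A ((repr x : cauchy_seq p) n)).
have Bcvg (u : cauchy_seq p) : A (u n) @[n --> \oo] --> B (\pi_(completion p)%qT u).
  set v : cauchy_seq p := repr (\pi_(completion p)%qT u).
  have /completionP/null_seqP vu0 :
      (\pi_(completion p) v = \pi_(completion p) u)%qT by rewrite reprK.
  have d0 : A (u n) - A (v n) @[n --> \oo] --> (0 : Y).
    apply: norm_cvg0.
    apply: (@squeeze_cvgr _ _ _ _ (fun=> 0) (fun n => C * p (v n - u n))).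
    - near=> n; rewrite normr_ge0/= -linearB (le_trans (AC _))//.
      by rewrite seminormB.
    - exact: cvg_cst.
    - by rewrite -[X in _ --> X](mulr0 C); apply: cvgMr.
  rewrite -[B _]add0r.
  rewrite (_ : (fun n => A (u n)) = (fun n => A (u n) - A (v n) + A (v n))).
    by apply: cvgD => //; exact: Acvg.
  by apply/funext => n; rewrite subrK.
have BE (u : cauchy_seq p) l : A (u n) @[n --> \oo] --> l ->
    B (\pi_(completion p)%qT u) = l.
  by move=> ul; apply: (cvg_unique _ (Bcvg u) ul); exact: norm_hausdorff.
exists B; split.
- move=> a; elim/quotW=> u; elim/quotW=> v.
  rewrite -completion_pi_scale -completion_pi_add; apply: BE.
  rewrite (_ : (fun n => _) = (fun n => a *: A (u n) + A (v n))); last first.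
    by apply/funext => n; rewrite -linearP.
  by apply: cvgD; [apply: cvgZr; exact: Bcvg|exact: Bcvg].
- by move=> x; apply: (BE (CauchySeq (cst_cauchy p x))) => /=; apply: cvg_cst.
- elim/quotW=> u.
  have CL : C * p (u n) @[n --> \oo] --> C * `|\pi_(completion p)%qT u|.
    by apply: cvgMr; exact: completion_norm_cvg.
  by apply: (ler_cvg_to (cvg_norm (Bcvg u)) CL); apply: nearW => n; exact: AC.
Unshelve. all: by end_near. Qed.

Lemma completion_dual (E : lmodType R) (p : seminorm E)
    (g : {linear E -> R^o}) (C : R) : 0 <= C -> (forall x, `|g x| <= C * p x) ->
  exists2 F : dual (completion p),
    (forall x, F (to_completion p x) = g x) & `|F| <= C.
Proof.
move=> C0 gC; have [f [fl fg fC]] := @completion_extend E p R^o g C C0 gC.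
have [F Ff FC] := bounded_linear_dual C0 fl fC.
by exists F => // x; rewrite Ff fg.
Qed.

End BoundedFunctionals.

(** * Finite representability *)

Section FiniteRepresentability.
Context {R : realType}.

Definition lin_span (V : lmodType R) n (e : 'I_n -> V) : set V :=
  range (fun c : 'I_n -> R => \sum_i c i *: e i).

Definition linear_on (V W : lmodType R) (E : set V) (T : V -> W) :=
  forall (a : R) x y, E x -> E y -> T (a *: x + y) = a *: T x + T y.

Lemma lin_span0 (V : lmodType R) n (e : 'I_n -> V) : lin_span e 0.
Proof. by exists (fun=> 0) => //; rewrite big1// => i _; rewrite scale0r. Qed.

Lemma lin_spanP (V : lmodType R) n (e : 'I_n -> V) (a : R) x y :
  lin_span e x -> lin_span e y -> lin_span e (a *: x + y).
Proof.
move=> [c _ <-] [d _ <-]; exists (fun i => a * c i + d i) => //.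
rewrite scaler_sumr -big_split/=; apply: eq_bigr => i _.
by rewrite scalerDl scalerA.
Qed.

Lemma mem_lin_span (V : lmodType R) n (e : 'I_n -> V) i : lin_span e (e i).
Proof.
exists (fun j => (j == i)%:R) => //; rewrite (bigD1 i)//= eqxx scale1r.
by rewrite big1 ?addr0// => j /negPf ->; rewrite scale0r.
Qed.

Lemma linear_on0 (V W : lmodType R) (E : set V) (T : V -> W) :
  linear_on E T -> E 0 -> T 0 = 0.
Proof.
move=> Tl E0; have := Tl 1 0 0 E0 E0; rewrite !scale1r addr0 => /eqP.
by rewrite -subr_eq0 opprD addNKr oppr_eq0 => /eqP.
Qed.

Lemma linear_onZ (V W : lmodType R) (E : set V) (T : V -> W) a x :
  linear_on E T -> E 0 -> E x -> T (a *: x) = a *: T x.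
Proof.
by move=> Tl E0 Ex; have := Tl a x 0 Ex E0; rewrite (linear_on0 Tl E0) !addr0.
Qed.

Lemma linear_on_bounded (V W : normedModType R) (E : set V) (T : V -> W) :
  fin_dim_subspace E -> linear_on E T ->
  exists2 C : R, 0 <= C & forall x, E x -> `|T x| <= C * `|x|.
Proof.
move=> /fin_dim_basis[n [e [ie ->]]] Tl; have [d d0 dP] := independent_lower ie.
have Tsum c : T (\sum_i c i *: e i) = \sum_i c i *: T (e i).
  suff: forall r : seq 'I_n, lin_span e (\sum_(i <- r) c i *: e i) /\
      T (\sum_(i <- r) c i *: e i) = \sum_(i <- r) c i *: T (e i).
    by move=> /(_ (index_enum _))[].
  elim=> [|i r [Er Tr]].
    by rewrite !big_nil; split; [exact: lin_span0|exact: linear_on0 (lin_span0 e)].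
  rewrite !big_cons -Tr -(Tl (c i) _ _ (mem_lin_span e i) Er); split=> //.
  exact: lin_spanP (mem_lin_span e i) Er.
have M0 : 0 <= \sum_i `|T (e i)| by apply: sumr_ge0.
exists (d^-1 * \sum_i `|T (e i)|); first by rewrite mulr_ge0 ?invr_ge0 ?(ltW d0).
move=> _ [c _ <-]; rewrite Tsum.
apply: (@le_trans _ _ ((\sum_i `|c i|) * \sum_i `|T (e i)|)).
  rewrite mulr_suml; apply: le_trans (ler_norm_sum _ _ _) _.
  apply: ler_sum => i _; rewrite normrZ ler_wpM2l//.
  by rewrite (bigD1 i)//= lerDl sumr_ge0.
by rewrite -mulrA mulrCA mulrC ler_wpM2l// ler_pdivlMl.
Qed.

Lemma opnorm_ub (V W : normedModType R) (E : set V) (T : V -> W) :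
  fin_dim_subspace E -> linear_on E T ->
  forall x, E x -> `|T x| <= opnorm E T * `|x|.
Proof.
move=> Efd Tl x Ex; have [C C0 TC] := linear_on_bounded Efd Tl.
have [n [e Ee]] := Efd.
have E0 : E 0 by rewrite Ee; exact: (lin_span0 e).
have EZ (a : R) y : E y -> E (a *: y).
  by move=> Ey; rewrite -[_ *: _]addr0; move: Ey E0; rewrite Ee; exact: lin_spanP.
have [x0|x0] := eqVneq `|x| 0; first by have := TC x Ex; rewrite x0 !mulr0.
have xp : 0 < `|x| by rewrite lt_def x0 normr_ge0.
rewrite -ler_pdivrMr// mulrC -[`|x|^-1]ger0_norm ?invr_ge0// -normrZ.
rewrite -(linear_onZ _ Tl)//; apply: ub_le_sup; last first.
  exists (`|x|^-1 *: x) => //; split; first exact: EZ.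
  by rewrite /= normrZ normfV normr_id mulVf.
exists C => _ [y [Ey /= y1] <-]; apply: le_trans (TC y Ey) _.
by rewrite -[leRHS]mulr1 ler_wpM2l.
Qed.

Lemma opnorm_le (V W : normedModType R) (E : set V) (T : V -> W) (C : R) :
  E 0 -> (forall x, E x -> `|T x| <= C * `|x|) -> 0 <= C ->
  0 <= opnorm E T <= C.
Proof.
move=> E0 TC C0; rewrite /opnorm; set S := image _ _.
have ubS : ubound S C.
  move=> _ [x [Ex /= x1] <-]; apply: le_trans (TC x Ex) _.
  by rewrite -[leRHS]mulr1 ler_wpM2l.
have S0 : S `|T 0| by exists 0 => //; split => //=; rewrite normr0.
apply/andP; split; last by apply: ge_sup => //; exists `|T 0|.
by apply: le_trans (normr_ge0 (T 0)) _; apply: ub_le_sup => //; exists C.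
Qed.

(** The copy of a subspace is determined by the images of a basis, and the
    lower bound makes these images independent. *)
Lemma finitely_representable_family (W V : normedModType R) :
  (forall n (e : 'I_n -> W) (t : R), independent e -> 0 < t -> t < 1 ->
    exists v : 'I_n -> V, forall c : 'I_n -> R,
      (1 - t) * `|\sum_i c i *: e i| <= `|\sum_i c i *: v i| /\
      `|\sum_i c i *: v i| <= (1 + t) * `|\sum_i c i *: e i|) ->
  finitely_representable W V.
Proof.
move=> h _ eps /fin_dim_basis[n [e [ie ->]]] eps0.
have e2 : 0 < 2 + eps by rewrite addr_gt0.
(* This choice makes [(1 + t) / (1 - t)] equal to [1 + eps]. *)
have [||v vP] := h n e (eps / (2 + eps)) ie.
- by rewrite divr_gt0.
- by rewrite ltr_pdivrMr// mul1r ltrDr.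
have iv : independent v.
  move=> c c0; apply: ie; apply/eqP; rewrite -normr_le0.
  have [+ _] := vP c; rewrite c0 normr0.
  rewrite pmulr_rle0 ?subr_gt0 ?ltr_pdivrMr ?mul1r ?ltrDr//.
have [k kE] := coordinates ie; have [l lE] := coordinates iv.
exists (lin_span v).
exists (fun x => \sum_i k x i *: v i), (fun y => \sum_i l y i *: e i); split.
- by exists n, v.
- move=> a _ _ [c _ <-] [d _ <-].
  have -> : a *: \sum_i c i *: e i + \sum_i d i *: e i =
      \sum_i (a * c i + d i) *: e i.
    rewrite scaler_sumr -big_split/=; apply: eq_bigr => i _.
    by rewrite scalerDl scalerA.
  rewrite !kE scaler_sumr -big_split/=; apply: eq_bigr => i _.
  by rewrite scalerDl scalerA.
- split=> [_ [c _ <-]|_ _ /set_mem[c _ <-] /set_mem[d _ <-]|_ [c _ <-]].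
  + by exists c => //; rewrite kE.
  + by rewrite !kE => /(independent_inj iv) ->.
  + by exists (\sum_i c i *: e i); [exists c|rewrite kE].
- by move=> _ /set_mem[c _ <-]; rewrite kE lE.
have t1 : 0 < 1 - eps / (2 + eps) by rewrite subr_gt0 ltr_pdivrMr// mul1r ltrDr.
have /andP[T0 T1] : 0 <= opnorm (lin_span e)
    (fun x => \sum_i k x i *: v i) <= 1 + eps / (2 + eps).
  apply: opnorm_le.
  - exact: lin_span0.
  - by move=> _ [c _ <-]; rewrite kE; exact: (vP c).2.
  - by rewrite addr_ge0// divr_ge0// ltW.
have /andP[S0 S1] : 0 <= opnorm (lin_span v)
    (fun x => \sum_i l x i *: e i) <= (1 - eps / (2 + eps))^-1.
  apply: opnorm_le.
  - exact: lin_span0.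
  - by move=> _ [c _ <-]; rewrite lE ler_pdivlMl//; exact: (vP c).1.
  - by rewrite invr_ge0 ltW.
apply: le_trans (ler_pM T0 S0 T1 S1) _.
rewrite ler_pdivrMr// le_eqVlt; apply/orP; left; apply/eqP.
by field; rewrite gt_eqF.
Qed.

(** One map for each finite list of vectors: the lists are directed by
    inclusion, so that limits along an ultrafilter make sense. *)
Lemma finitely_representable_maps (W V : normedModType R) (s : seq W) :
  finitely_representable W V -> exists (E : set W) (T : W -> V),
  [/\ forall x, x \in s -> E x, linear_on E T &
      forall x, E x -> `|x| <= `|T x| /\ `|T x| <= 2 * `|x|].
Proof.
move=> WV; pose e (i : 'I_(size s)) := nth 0 s i; pose E := lin_span e.
have Efd : fin_dim_subspace E by exists (size s), e.
have [F [T [S [Ffd Tl [TF Ti Ts] TS TS2]]]] := WV E 1 Efd ltr01.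
have TSE x : E x -> S (T x) = x by move=> Ex; apply: TS; exact/mem_set.
have Sl : linear_on F S.
  move=> a x y Fx Fy; have [x' Ex <-] := Ts _ Fx; have [y' Ey <-] := Ts _ Fy.
  by rewrite -Tl// !TSE//; exact: lin_spanP.
have [D D0 SD] := linear_on_bounded Ffd Sl.
have F0 : F 0 by rewrite -(linear_on0 Tl (lin_span0 e)); exact/TF/lin_span0.
have /andP[S0 _] := opnorm_le F0 SD D0.
(* Rescaling makes the distortion bound two-sided. *)
exists E, (fun x => opnorm F S *: T x); split.
- move=> x /(nthP 0)[i si <-]; exact: (mem_lin_span e (Ordinal si)).
- by move=> a x y Ex Ey; rewrite Tl// scalerDr !scalerA mulrC.
- move=> x Ex; rewrite normrZ (ger0_norm S0); split.
    by rewrite -{1}(TSE x Ex) (opnorm_ub Ffd Sl)//; exact: TF.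
  apply: le_trans (ler_wpM2l S0 (opnorm_ub Efd Tl Ex)) _.
  by rewrite mulrA ler_wpM2r// mulrC.
Qed.

End FiniteRepresentability.

Lemma ler_cvg_filter {R : realType} {T : Type} {F : set_system T}
    {FF : ProperFilter F} (f g : T -> R) (l l' : R) :
  f t @[t --> F] --> l -> g t @[t --> F] --> l' ->
  (\forall t \near F, f t <= g t) -> l <= l'.
Proof.
move=> fl gl fg; rewrite leNgt; apply/negP => ll.
have f1 : \forall t \near F, (l + l') / 2 < f t by apply: (cvgr_gt l) => //; lra.
have g1 : \forall t \near F, g t < (l + l') / 2 by apply: (cvgr_lt l') => //; lra.
have [t [ft [gt ht]]] := filter_ex (filterI f1 (filterI g1 fg)); lra.
Qed.

(** * Completions of limits of norms *)

Section UltraSeminorm.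
Context {R : realType} {I : Type} (U : set_system I) {UU : UltraFilter U}.
Context {V : normedModType R} {L : lmodType R} (A : I -> L -> V).
(* The maps are linear in the limit: each linear relation holds for almost all
   indices, which depend on the vectors. *)
Hypothesis Alin : forall (a : R) x y,
  \forall i \near U, A i (a *: x + y) = a *: A i x + A i y.
Hypothesis Abnd : forall x, exists M : R, \forall i \near U, `|A i x| <= M.

Let q x := ulim U (fun i => `|A i x|).

Let q_cvg x : `|A i x| @[i --> U] --> q x.
Proof.
have [M AM] := Abnd x; apply: (@ulim_cvg _ _ _ _ _ M).
by apply: filterS AM => i; rewrite normr_id.
Qed.

Let A0 : \forall i \near U, A i 0 = 0.
Proof.
apply: filterS (Alin 1 0 0) => i; rewrite !scale1r addr0 => /eqP.
by rewrite -subr_eq0 opprD addNKr oppr_eq0 => /eqP.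
Qed.

Let qD x y : q (x + y) <= q x + q y.
Proof.
have qxy : `|A i x| + `|A i y| @[i --> U] --> q x + q y by exact: cvgD.
apply: (ler_cvg_filter (@q_cvg (x + y)) qxy).
have := Alin 1 x y; apply: filterS => i; rewrite !scale1r => ->.
exact: ler_normD.
Qed.

Let qZ a x : q (a *: x) = `|a| * q x.
Proof.
have h : `|a| * `|A i x| @[i --> U] --> `|a| * q x by exact: cvgMr.
apply: ulim_eq; apply: (cvg_trans _ h).
apply: near_eq_cvg; near=> i.
have -> : A i (a *: x) = a *: A i x + A i 0.
  by rewrite -{1}[a *: x]addr0; near: i; exact: Alin.
rewrite (_ : A i 0 = 0) ?addr0 ?normrZ//.
by near: i; exact: A0.
Unshelve. all: by end_near. Qed.

Definition ultra_seminorm : seminorm L := Seminorm qD qZ.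

Lemma ultra_seminorm_cvg x : `|A i x| @[i --> U] --> ultra_seminorm x.
Proof. exact: q_cvg. Qed.

Lemma ultra_combination n (l : 'I_n -> L) (c : 'I_n -> R) :
  \forall i \near U, A i (\sum_j c j *: l j) = \sum_j c j *: A i (l j).
Proof.
elim: n l c => [|n IH] l c.
  by apply: filterS A0 => i Ai0; rewrite !big_ord0.
have h1 := Alin (c ord0) (l ord0) (\sum_j c (lift ord0 j) *: l (lift ord0 j)).
have h2 := IH (fun j => l (lift ord0 j)) (fun j => c (lift ord0 j)).
near=> i; rewrite !big_ord_recl; transitivity
  (c ord0 *: A i (l ord0) + A i (\sum_j c (lift ord0 j) *: l (lift ord0 j))).
  by near: i; exact: h1.
by congr (_ + _); near: i; exact: h2.
Unshelve. all: by end_near. Qed.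

(** By compactness of the coefficients the limit defining the seminorm is
    uniform on finite-dimensional subspaces. *)
Lemma ultra_seminorm_uniform n (l : 'I_n -> L) (t : R) : 0 < t ->
  \forall i \near U, forall c : 'I_n -> R,
    `|ultra_seminorm (\sum_j c j *: l j) - `|\sum_j c j *: A i (l j)| |
    <= t * \sum_j `|c j|.
Proof.
(* Normalized coefficients [c i] that violate the estimate for almost all [i]
   have a limit [k], at which the pointwise convergence is contradicted. *)
move=> t0; apply: contrapT => nU; pose p := ultra_seminorm.
have {}nU : \forall i \near U, exists c : 'I_n -> R, \sum_j `|c j| = 1 /\
    t < `|p (\sum_j c j *: l j) - `|\sum_j c j *: A i (l j)| |.
  case: (@in_ultra_setVsetC I U [set i | forall c : 'I_n -> R,
    `|p (\sum_j c j *: l j) - `|\sum_j c j *: A i (l j)| |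
    <= t * \sum_j `|c j|] UU) => // UnA.
  apply: filterS UnA => i /existsNP[c /negP]; rewrite -ltNge => cP.
  have s0 : 0 < \sum_j `|c j|.
    rewrite lt_def sumr_ge0// andbT; apply/negP => /eqP s0.
    have c0 j : c j = 0.
      apply/eqP; rewrite -normr_eq0 eq_le normr_ge0 andbT -s0.
      by rewrite (bigD1 j)//= lerDl sumr_ge0.
    have z (W : lmodType R) (v : 'I_n -> W) : \sum_j c j *: v j = 0.
      by apply: big1 => j _; rewrite c0 scale0r.
    by move: cP; rewrite s0 mulr0 !z (seminorm0 p) normr0 subrr normr0 ltxx.
  exists (fun j => (\sum_j `|c j|)^-1 * c j); split.
    under eq_bigr do rewrite normrM normfV (gtr0_norm s0).
    by rewrite -mulr_sumr mulVf ?gt_eqF.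
  have z (W : lmodType R) (v : 'I_n -> W) :
      \sum_j ((\sum_j `|c j|)^-1 * c j) *: v j = (\sum_j `|c j|)^-1 *: \sum_j c j *: v j.
    by rewrite scaler_sumr; apply: eq_bigr => j _; rewrite scalerA.
  rewrite !z normrZ (seminormZ p) normfV (gtr0_norm s0) -mulrBr.
  by rewrite normrM normfV (gtr0_norm s0) ltr_pdivlMl// mulrC.
have [c cP] : exists c : I -> 'I_n -> R, \forall i \near U,
    \sum_j `|c i j| = 1 /\
    t < `|p (\sum_j c i j *: l j) - `|\sum_j c i j *: A i (l j)| |.
  have h i : exists c : 'I_n -> R, (exists c : 'I_n -> R, \sum_j `|c j| = 1 /\
      t < `|p (\sum_j c j *: l j) - `|\sum_j c j *: A i (l j)| |) ->
      \sum_j `|c j| = 1 /\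
      t < `|p (\sum_j c j *: l j) - `|\sum_j c j *: A i (l j)| |.
    case: (pselect (exists c : 'I_n -> R, \sum_j `|c j| = 1 /\
      t < `|p (\sum_j c j *: l j) - `|\sum_j c j *: A i (l j)| |)) => [[c cP]|h].
      by exists c.
    by exists (fun=> 0).
  by have [c cP] := choice h; exists c; apply: filterS nU => i; exact: cP.
have cl j : c i j @[i --> U] --> ulim U (c^~ j).
  apply: (@ulim_cvg _ _ _ _ _ 1); apply: filterS cP => i [<- _].
  by rewrite (bigD1 j)//= lerDl sumr_ge0.
set k := fun j => ulim U (c^~ j).
pose err i := \sum_j `|c i j - k j| * (p (l j) + `|A i (l j)|).
have err0 : err i @[i --> U] --> (0 : R).
  rewrite /err.
  rewrite [X in _ --> X](_ : _ =
    \sum_(j < n) `|k j - k j| * (p (l j) + p (l j))).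
    apply: cvg_finite_sum => j; apply: cvgM.
      by apply: cvg_norm; apply: cvgB; [exact: cl|exact: cvg_cst].
    by apply: cvgD; [exact: cvg_cst|exact: q_cvg].
  by rewrite big1// => j _; rewrite subrr normr0 mul0r.
have limk : `|A i (\sum_j k j *: l j)| @[i --> U] --> p (\sum_j k j *: l j).
  exact: q_cvg.
have t20 : 0 < t / 2 by rewrite divr_gt0.
have n1 : \forall i \near U, err i < t / 2 by apply: (cvgr_lt (0 : R)).
have n2 : \forall i \near U,
    `|p (\sum_j k j *: l j) - `|A i (\sum_j k j *: l j)| | < t / 2.
  by move/cvgrPdist_lt : limk; exact.
have n3 := ultra_combination l k.
have [i [[i1 i2] [i3 [_ i4]]]] :=
  filter_ex (filterI (filterI n1 n2) (filterI n3 cP)).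
have {}i2 : `|p (\sum_j k j *: l j) - `|\sum_j k j *: A i (l j)| | < t / 2.
  by rewrite -i3.
have := norm_sum_dist (fun j => A i (l j)) (c i) k.
have : `|p (\sum_j c i j *: l j) - p (\sum_j k j *: l j)|
    <= \sum_j `|c i j - k j| * p (l j).
  apply: le_trans (seminorm_dist p _ _) _; rewrite -sumrB.
  apply: (big_ind2 (fun x y => p x <= y)) => [|x a y b xa yb|j _].
    by rewrite seminorm0.
    by apply: le_trans (seminormD p _ _) _; rewrite lerD.
  by rewrite -scalerBl (seminormZ p).
have : err i = \sum_j `|c i j - k j| * p (l j) +
    \sum_j `|c i j - k j| * `|A i (l j)|.
  by rewrite -big_split/=; apply: eq_bigr => j _; rewrite mulrDr.
have key (a b d x y z w : R) : a < t / 2 -> `|y - w| < t / 2 ->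
    t < `|x - z| -> a = b + d -> `|x - y| <= b -> `|z - w| <= d -> False.
  rewrite ltr_norml ltr_normr !ler_norml => ? /andP[? ?] /orP[?|?] ? /andP[? ?];
  by move=> /andP[? ?]; lra.
by exact: (key _ _ _ _ _ _ _ i1 i2 i4).
Qed.

(** A basis [e] of a subspace of the completion is moved into [L] with an error
    that is small compared with the equivalence constant [d] of [e]; by
    uniformity one index then serves for all linear combinations. *)
Lemma ultra_completion_finitely_representable :
  finitely_representable (completion ultra_seminorm) V.
Proof.
set p := ultra_seminorm.
apply: finitely_representable_family => n e t ie t0 t1.
have [d d0 dP] := independent_lower ie.
have td : 0 < t * d / 2 by rewrite !divr_gt0 ?mulr_gt0.
have hl i : exists y, `|e i - to_completion p y| < t * d / 2.
  exact: to_completion_dense.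
have [l lP] := choice hl.
have [i iP] := filter_ex (ultra_seminorm_uniform l td).
exists (fun j => A i (l j)) => c.
have := iP c; have : `| (`|\sum_j c j *: e j|) - p (\sum_j c j *: l j)|
    <= t * d / 2 * \sum_j `|c j|.
  rewrite -to_completion_norm; apply: le_trans (ler_dist_dist _ _) _.
  rewrite linear_sum -sumrB mulr_sumr; apply: le_trans (ler_norm_sum _ _ _) _.
  apply: ler_sum => j _; rewrite linearZZ -scalerBr normrZ mulrC ler_wpM2r//.
  by rewrite ltW.
have := ler_wpM2l (ltW t0) (dP c).
rewrite -/p !ler_norml; set B := `|_|; set C := p _; set D := `|_|.
rewrite mulrA; set s := \sum_j _ => h /andP[h1 h2] /andP[h3 h4].
have e1 : t * d / 2 * s = t * d * s / 2 by rewrite mulrAC.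
rewrite e1 in h1 h2 h3 h4; move: h h1 h2 h3 h4; set z := t * d * s => h h1 h2 h3 h4.
by split; lra.
Qed.

End UltraSeminorm.

(** * Superreflexivity and embeddings in finite powers *)

Section JointReflexivity.
Context {R : realType} {W : completeNormedModType R} {n : nat}.
Variables (p : 'I_n -> seminorm W).

Let sumD (K : R) : 0 <= K -> forall v w : 'I_n -> W,
  K * \sum_i p i ((v + w) i) <= K * \sum_i p i (v i) + K * \sum_i p i (w i).
Proof.
move=> K0 v w; rewrite -mulrDr ler_wpM2l// -big_split/=.
by apply: ler_sum => i _; exact: seminormD.
Qed.

Let sumZ (K : R) (a : R) (v : 'I_n -> W) :
  K * \sum_i p i ((a *: v) i) = `|a| * (K * \sum_i p i (v i)).
Proof.
rewrite mulrCA; congr (_ * _); rewrite mulr_sumr; apply: eq_bigr => i _.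
exact: seminormZ.
Qed.

(** Extend [g] to the power of [W] with the sum of the seminorms by the
    Hahn-Banach theorem; on the i-th coordinate axis the extension is dominated
    by the i-th seminorm alone, and so extends to its completion. *)
Lemma dominated_decomposition (Z : lmodType R) (j : {linear Z -> ('I_n -> W)})
    (g : {linear Z -> R^o}) (K : R) : 0 <= K ->
  (forall z, g z <= K * \sum_i p i (j z i)) ->
  exists F : forall i, dual (completion (p i)),
    (forall z, g z = \sum_i F i (to_completion (p i) (j z i))) /\
    forall i, `|F i| <= K.
Proof.
move=> K0 gK.
pose q : seminorm ('I_n -> W) := Seminorm (sumD K0) (sumZ K).
have [G Gl [Gg Gq]] := hahn_banach (q := q) gK.
pose G' : {linear ('I_n -> W) -> R^o} :=
  HB.pack G (GRing.isLinear.Build _ _ _ _ G Gl).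
pose single i x : 'I_n -> W := fun k => if k == i then x else 0.
have sl i : linear (fun x => G (single i x)).
  move=> a x y; rewrite -Gl; congr (G _); apply/funext => k.
  rewrite -[RHS]/(a *: single i x k + single i y k) /single.
  by case: eqP => // _; rewrite scaler0 addr0.
pose s i : {linear W -> R^o} :=
  HB.pack (fun x => G (single i x)) (GRing.isLinear.Build _ _ _ _ _ (sl i)).
have sq i x : `|s i x| <= K * p i x.
  apply: le_trans (Gq _) _; rewrite /= (bigD1 i)//= {1}/single eqxx big1 ?addr0//.
  by move=> k /negPf ki; rewrite /single ki (seminorm0 (p k)).
have h i : exists F : dual (completion (p i)),
    (forall x, F (to_completion (p i) x) = s i x) /\ `|F| <= K.
  by have [F FE FK] := completion_dual K0 (sq i); exists F.
exists (fun i => sval (cid (h i))); split=> [z|i]; last first.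
  by have [] := svalP (cid (h i)).
have jz : j z = \sum_i single i (j z i); last first.
  rewrite -Gg [in LHS]jz -[G _]/(G' _) linear_sum; apply: eq_bigr => i _.
  by have [-> _] := svalP (cid (h i)).
apply/funext => k; rewrite fct_sumE (bigD1 k)//= {1}/single eqxx big1 ?addr0//.
by move=> i /negPf ik; rewrite /single eq_sym ik.
Qed.

Variable (C : R).
Hypothesis C0 : 0 < C.
Hypothesis pC : forall i x, p i x <= C * `|x|.
Hypothesis normC : forall x : W, `|x| <= C * \sum_i p i x.

(** An element [phi] of the bidual of [W] induces an element of the bidual of
    each completion, that is, a point [x i].  The family [x] is approximated by
    the diagonal image of [W]: otherwise a functional on the product would
    vanish on this image but not at [x], while its pairing with [x] is the
    value of [phi] at its restriction to [W].  As [W] is complete, [x] is the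
    image of some [w], which represents [phi] because each functional on [W]
    is a sum of functionals on the completions. *)
Lemma reflexive_joint : (forall i, reflexive_space (completion (p i))) ->
  reflexive_space W.
Proof.
move=> refl phi.
have pull i (F : dual (completion (p i))) : exists f : dual W,
    (forall x, f x = F (to_completion (p i) x)) /\ `|f| <= C * `|F|.
  have [||x|f fF fC] := @bounded_linear_dual R W
      (fun x => F (to_completion (p i) x)) (C * `|F|).
  - by rewrite mulr_ge0// ltW.
  - by move=> a x y; rewrite !linearP.
  - apply: le_trans (dual_norm_le _ _) _; rewrite to_completion_norm.
    by rewrite (mulrC C) -mulrA ler_wpM2l.
  - by exists f.
pose pb i F := sval (cid (pull i F)).
have pbE i F x : pb i F x = F (to_completion (p i) x).
  by have [] := svalP (cid (pull i F)).
have pbC i F : `|pb i F| <= C * `|F| by have [] := svalP (cid (pull i F)).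
have hx i : exists x : completion (p i), forall F, phi (pb i F) = F x.
  have [|||Phi PhiE _] := @bounded_linear_dual R (dual (completion (p i)))
      (fun F => phi (pb i F)) (`|phi| * C).
  - by rewrite mulr_ge0// ltW.
  - move=> a F G; rewrite -linearP; congr (phi _); apply/val_inj/funext => x /=.
    rewrite -[RHS]/(a *: pb i F x + pb i G x) !pbE.
    by rewrite -[LHS]/(a *: F _ + G _).
  - move=> F; apply: le_trans (dual_norm_le _ _) _; rewrite -mulrA.
    by rewrite ler_wpM2l.
  - by have [x xP] := refl i Phi; exists x => F; rewrite -PhiE xP.
have [x xE] : exists x : forall i, completion (p i),
    forall i F, phi (pb i F) = F (x i).
  by exists (fun i => sval (cid (hx i))) => i; exact: svalP (cid (hx i)).
(* [phi] acts on sums of pulled-back functionals as evaluation at [x]. *)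
have phiE (f : dual W) (F : forall i, dual (completion (p i))) :
    (forall w, f w = \sum_i F i (to_completion (p i) w)) ->
    phi f = \sum_i F i (x i).
  move=> fF; under eq_bigr do rewrite -xE; rewrite -linear_sum; congr (phi _).
  apply/val_inj/funext => w /=; rewrite fF.
  have -> : (\sum_i pb i (F i)) w = \sum_i pb i (F i) w.
    by apply: (big_morph (fun f : dual W => f w)).
  by apply: eq_bigr => i _; rewrite pbE.
have approx (t : R) : 0 < t ->
    exists w, forall i, `|x i - to_completion (p i) w| < t.
  (* The [n] errors of size [e] stay below the distance [n.+1 * e]. *)
  move=> t0; pose e := t / (2 * n.+1%:R).
  have n0 : 0 < n.+1%:R :> R by [].
  have e0 : 0 < e by rewrite divr_gt0// mulr_gt0.
  have hv i : exists v, `|x i - to_completion (p i) v| < e.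
    exact: to_completion_dense.
  have [v vP] := choice hv.
  have [[w wP]|nw] := pselect (exists w, \sum_i p i (v i - w) < n.+1%:R * e).
    exists w => i; apply: le_lt_trans (ler_distD (to_completion (p i) (v i)) _ _) _.
    have -> : t = e + (n.+1%:R * e + (t / 2 - e)) by rewrite /e; field; rewrite gt_eqF.
    apply: ltrD => //; rewrite -linearB to_completion_norm.
    apply: (@lt_le_trans _ _ (n.+1%:R * e)).
      apply: le_lt_trans wP; rewrite (bigD1 i)//= lerDl sumr_ge0// => k _.
      exact: seminorm_ge0.
    rewrite lerDl subr_ge0 /e invfM mulrA ler_piMr//; first by rewrite divr_ge0// ltW.
    by rewrite invf_le1// ler1n.
  (* The separating functional is 0 on the diagonal and positive at [v]. *)
  pose Z := (W * R^o)%type.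
  pose j (z : Z) : 'I_n -> W := fun i => z.1 + z.2 *: v i.
  pose g (z : Z) : R^o := z.2 * (n.+1%:R * e).
  have jl : linear j.
    move=> a y z; apply/funext => i.
    rewrite -[RHS]/(a *: (y.1 + y.2 *: v i) + (z.1 + z.2 *: v i)) /j /=.
    by rewrite scalerDl scalerDr scalerA addrACA.
  have gl : linear g.
    by move=> a y z; rewrite /g /= mulrDl; congr (_ + _); exact/esym/mulrA.
  pose J : {linear Z -> ('I_n -> W)} := HB.pack j (GRing.isLinear.Build _ _ _ _ j jl).
  pose G : {linear Z -> R^o} := HB.pack g (GRing.isLinear.Build _ _ _ _ g gl).
  have [|F [FE F1]] := @dominated_decomposition Z J G 1 ler01.
    move=> [w s]; rewrite /= /j /g /= mul1r.
    have [s0|s0] := leP s 0.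
      apply: (@le_trans _ _ 0); first by rewrite mulr_le0_ge0// mulr_ge0// ltW.
      by apply: sumr_ge0 => i _; exact: seminorm_ge0.
    have -> : \sum_i p i (w + s *: v i) = s * \sum_i p i (v i - - s^-1 *: w).
      rewrite mulr_sumr; apply: eq_bigr => i _.
      rewrite -{2}(gtr0_norm s0) -seminormZ scalerBr scaleNr scalerN opprK scalerA.
      by rewrite mulfV ?gt_eqF// scale1r addrC.
    apply: ler_wpM2l; first exact: ltW.
    rewrite leNgt; apply/negP => h.
    by apply: nw; exists (- s^-1 *: w).
  have z0 : \sum_i F i (x i) = 0.
    rewrite -(phiE 0) ?linear0// => w.
    have := FE (w, 0); rewrite /= /g /j /= mul0r => e1.
    rewrite -[LHS]/(0 : R) [LHS]e1.
    by apply: eq_bigr => i _; rewrite scale0r addr0.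
  have d1 : n.+1%:R * e = \sum_i F i (to_completion (p i) (v i)).
    have := FE (0, 1); rewrite /= /g /j /= mul1r => ->.
    by apply: eq_bigr => i _; rewrite scale1r add0r.
  have : n.+1%:R * e <= n%:R * e.
    have -> : n.+1%:R * e = \sum_i F i (to_completion (p i) (v i) - x i).
      by under eq_bigr do rewrite linearB; rewrite sumrB z0 subr0.
    rewrite -[n in leRHS]card_ord mulr_natl -sumr_const.
    apply: ler_sum => i _; apply: le_trans (ler_norm _) _.
    apply: le_trans (dual_norm_le _ _) _; rewrite -[leRHS]mul1r.
    apply: ler_pM => //.
    by rewrite distrC; exact/ltW/vP.
  by rewrite ler_pM2r// ler_nat ltnn.
have [w wP] : exists w, forall i, x i = to_completion (p i) w.
  have ha (m : nat) :
      exists w, forall i, `|x i - to_completion (p i) w| < m.+1%:R^-1.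
    by apply: approx; rewrite invr_gt0.
  have [u uP] := choice ha.
  have ucvg : cvgn u.
    apply/cauchy_cvgP; apply: cauchy_exP => t t0.
    pose e := t / (2 * (C * n.+1%:R)).
    have n0 : 0 < n.+1%:R :> R by [].
    have e0 : 0 < e by rewrite divr_gt0// !mulr_gt0.
    have [N _ NP] := near_infty_natSinv_lt (PosNum e0).
    exists (u N); exists N => // m /= Nm; rewrite -ball_normE/=.
    apply: le_lt_trans (normC _) _.
    apply: (@le_lt_trans _ _ (C * \sum_(i < n) (2 * e))).
      rewrite ler_wpM2l ?(ltW C0)//; apply: ler_sum => i _.
      rewrite -to_completion_norm linearB.
      apply: le_trans (ler_distD (x i) _ _) _; rewrite mulr_natl mulr2n lerD//.
        by rewrite distrC ltW// (lt_trans (uP N i))//; exact: NP N (leqnn N).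
      by rewrite ltW// (lt_trans (uP m i))//; exact: NP m Nm.
    rewrite sumr_const card_ord -[(_ *+ n)]mulr_natl.
    have -> : t = C * (n.+1%:R * (2 * e)).
      by rewrite /e; field; rewrite !gt_eqF.
    have e20 : 0 < 2 * e by rewrite mulr_gt0.
    by rewrite (ltr_pM2l C0) (ltr_pM2r e20) ltr_nat.
  exists (limn u) => i; apply/eqP; rewrite -subr_eq0 -normr_le0.
  have h1 : m.+1%:R^-1 + C * `|u m - limn u| @[m --> \oo] --> (0 : R).
    rewrite -[X in _ --> X](addr0 0) -[X in _ + X](mulr0 C); apply: cvgD.
      exact: cvg_harmonic.
    apply: cvgMr; rewrite -(@normr0 _ W) -(subrr (limn u)).
    by apply: cvg_norm; apply: cvgB => //; exact: cvg_cst.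
  apply: (ler_cvg_filter (cvg_cst _) h1); apply: nearW => m.
  apply: le_trans (ler_distD (to_completion (p i) (u m)) _ _) _; rewrite lerD//.
    by rewrite ltW.
  by rewrite -linearB to_completion_norm.
exists w => f.
pose jj (z : W) : 'I_n -> W := fun=> z.
have jjl : linear jj by [].
pose J : {linear W -> ('I_n -> W)} := HB.pack jj (GRing.isLinear.Build _ _ _ _ jj jjl).
have [||F [FE _]] := @dominated_decomposition W J f (`|f| * C).
- by rewrite mulr_ge0// ltW.
- move=> z; apply: le_trans (ler_norm _) _; apply: le_trans (dual_norm_le _ _) _.
  by rewrite -mulrA ler_wpM2l.
by rewrite (phiE f F)//; rewrite FE; apply: eq_bigr => i _; rewrite wP.
Qed.

End JointReflexivity.

Section Superreflexivity.
Context {R : realType}.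

(** A space finitely representable in [V] carries seminorms, one for each
    coordinate, whose completions are finitely representable in [Y]. *)
Lemma superreflexive_embed (V Y : completeNormedModType R) n
    (P : 'I_n -> {linear V -> Y}) (C : R) : 0 < C ->
  (forall i v, `|P i v| <= C * `|v|) ->
  (forall v : V, `|v| <= C * \sum_i `|P i v|) ->
  superreflexive Y -> superreflexive V.
Proof.
move=> C0 PC VC sY W WV.
have [E EP] := choice (fun s => finitely_representable_maps s WV).
have {EP} [T TP] := choice EP.
have [U [UU sU]] : exists U : set_system (seq W),
    UltraFilter U /\ forall w : W, U [set s : seq W | w \in s].
  pose B := filter_from [set: seq W] (fun s0 => [set s : seq W | {subset s0 <= s}]).
  have BF : ProperFilter B.
    apply: filter_from_proper; last by move=> s _; exists s.
    apply: filter_from_filter; first by exists [::].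
    move=> s t _ _; exists (s ++ t) => // r h.
    by split=> z zs; apply: h; rewrite mem_cat zs ?orbT.
  have [U [UU BU]] := ultraFilterLemma BF; exists U; split=> // w.
  by apply: BU; exists [:: w] => // s; apply; rewrite mem_head.
pose A i s w := P i (T s w).
have Alin i (a : R) x y :
    \forall s \near U, A i s (a *: x + y) = a *: A i s x + A i s y.
  near=> s; have [sE Tl _] := TP s; rewrite /A Tl ?linearP//; apply: sE.
    by near: s; exact: sU.
  by near: s; exact: sU.
have Abnd' i x : \forall s \near U, `|A i s x| <= 2 * C * `|x|.
  near=> s; have [sE _ Tb] := TP s; apply: le_trans (PC i _) _.
  rewrite (mulrC 2) -mulrA; apply: ler_wpM2l; first exact: ltW.
  by apply: (Tb x _).2; apply: sE; near: s; exact: sU.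
have Abnd i x : exists M : R, \forall s \near U, `|A i s x| <= M.
  by exists (2 * C * `|x|).
pose p i := @ultra_seminorm R (seq W) U UU Y W (A i) (Alin i) (Abnd i).
have pcvg i x : `|A i s x| @[s --> U] --> p i x.
  exact: ultra_seminorm_cvg.
have C2 : 0 < 2 * C by rewrite mulr_gt0.
apply: (@reflexive_joint R W n p (2 * C) C2).
- move=> i x; apply: (ler_cvg_filter (pcvg i x) (cvg_cst (2 * C * `|x|))).
  exact: Abnd'.
- move=> x; have h : 2 * C * \sum_i `|A i s x| @[s --> U] --> 2 * C * \sum_i p i x.
    by apply: cvgMr; apply: cvg_finite_sum => i; exact: ultra_seminorm_cvg.
  apply: (ler_cvg_filter (cvg_cst `|x|) h); near=> s; have [sE _ Tb] := TP s.
  apply: (@le_trans _ _ `|T s x|).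
    by apply: (Tb x _).1; apply: sE; near: s; exact: sU.
  apply: le_trans (VC _) _; rewrite -mulrA ler_peMl ?ler1n//.
  by rewrite mulr_ge0 ?sumr_ge0 ?(ltW C0).
- by move=> i; apply: sY; exact: ultra_completion_finitely_representable.
Unshelve. all: by end_near. Qed.

End Superreflexivity.

(** * The Dvoretzky-Rogers lemma *)

Section DvoretzkyRogers.
Context {R : realType}.

Section EuclideanNorm.
Context {n : nat}.
Implicit Types a b v : 'rV[R]_n.

Definition dot a b : R := \sum_i a 0 i * b 0 i.
Definition norm2 a : R := Num.sqrt (dot a a).

Lemma dot_ge0 a : 0 <= dot a a.
Proof. by apply: sumr_ge0 => i _; rewrite -expr2 sqr_ge0. Qed.

Lemma dotE a b : a *m b^T = (dot a b)%:M.
Proof.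
apply/matrixP => i j; rewrite !ord1 !mxE eqxx mulr1n.
by apply: eq_bigr => k _; rewrite !mxE.
Qed.

Lemma norm2_ge0 a : 0 <= norm2 a. Proof. exact: sqrtr_ge0. Qed.

Lemma norm2_coord a i : `|a 0 i| <= norm2 a.
Proof.
rewrite -sqrtr_sqr; apply: ler_wsqrtr; rewrite /dot (bigD1 i)//= -expr2 lerDl.
by apply: sumr_ge0 => j _; rewrite -expr2 sqr_ge0.
Qed.

Lemma norm2_le a b : (forall i, `|a 0 i| <= `|b 0 i|) -> norm2 a <= norm2 b.
Proof.
move=> ab; apply/ler_wsqrtr/ler_sum => i _.
rewrite -!expr2 -[leLHS]real_normK ?num_real// -[leRHS]real_normK ?num_real//.
by rewrite ler_sqr ?nnegrE.
Qed.

Lemma norm2_isometry (S : 'M[R]_n) a : S *m S^T = 1%:M -> norm2 (a *m S) = norm2 a.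
Proof.
move=> SS; congr Num.sqrt; have := dotE (a *m S) (a *m S).
rewrite trmx_mul mulmxA -(mulmxA a) SS mulmx1 dotE => /matrixP/(_ 0 0).
by rewrite !mxE eqxx !mulr1n => ->.
Qed.

(** The reflection in the hyperplane orthogonal to [delta_mx 0 j - a].  It fixes
    the basis vectors orthogonal to both, so that a sequence of vectors chosen
    one by one can be rotated to the first rows of a matrix. *)
Lemma householder (j : 'I_n) a : dot a a = 1 ->
  exists S : 'M[R]_n, [/\ S *m S^T = 1%:M, row j S = a &
    forall i, i != j -> a 0 i = 0 -> row i S = delta_mx 0 i].
Proof.
move=> a1; pose v : 'rV[R]_n := delta_mx 0 j - a.
have dE b : dot (delta_mx 0 j) b = b 0 j.
  rewrite /dot (bigD1 j)//= mxE !eqxx mul1r big1 ?addr0// => i ij.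
  by rewrite mxE (negPf ij) andbF mul0r.
have v2 : dot v v = 2 * (1 - a 0 j).
  have -> : dot v v = dot (delta_mx 0 j) v - (dot (delta_mx 0 j) a - dot a a).
    by rewrite /dot -!sumrB; apply: eq_bigr => i _; rewrite !mxE; ring.
  by rewrite !dE a1 !mxE !eqxx /=; ring.
have [e|ne] := eqVneq (a 0 j) 1.
  have v0 : v = 0.
    apply/rowP => i; rewrite [RHS]mxE; apply/eqP; rewrite -normr_le0.
    apply: le_trans (norm2_coord v i) _.
    by rewrite /norm2 v2 e subrr mulr0 sqrtr0.
  have aj : delta_mx 0 j = a by apply/eqP; rewrite -subr_eq0 -/v v0.
  exists 1%:M; split; first by rewrite trmx1 mulmx1.
    by rewrite row1 aj.
  by move=> i _ _; rewrite row1.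
have s0 : dot v v != 0 by rewrite v2 mulf_neq0// subr_eq0 eq_sym.
(* [S] is [1 - 2 P], with [P] the orthogonal projection onto the line of [v]. *)
pose c := 2 / dot v v.
pose S : 'M[R]_n := 1%:M - c *: (v^T *m v).
have rowS i : row i S = delta_mx 0 i - (c * v 0 i) *: v.
  by apply/rowP => k; rewrite !mxE big_ord1 !mxE eqxx /= (eq_sym k i) -mulrA.
exists S; split.
- have ST : S^T = S by rewrite /S raddfB /= trmx1 linearZ /= trmx_mul trmxK.
  have VV : (v^T *m v) *m (v^T *m v) = dot v v *: (v^T *m v).
    by rewrite mulmxA -(mulmxA v^T v) dotE mul_mx_scalar -scalemxAl.
  rewrite ST /S; move: (v^T *m v) VV => V VV.
  rewrite mulmxBl mul1mx mulmxBr mulmx1 -scalemxAl -scalemxAr VV.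
  apply/matrixP => p q; rewrite !mxE.
  by rewrite /c; field.
- rewrite rowS; have -> : c * v 0 j = 1.
    rewrite /c v2 !mxE !eqxx /=; field.
    by rewrite subr_eq0 eq_sym.
  by rewrite scale1r /v opprB addrCA subrr addr0.
- move=> i ij ai; rewrite rowS.
  have -> : v 0 i = 0 by rewrite !mxE (negPf ij) andbF ai subr0.
  by rewrite mulr0 scale0r subr0.
Qed.

End EuclideanNorm.

Section Volume.
Context {X : normedModType R} {n : nat} (e : 'I_n -> X).
Hypothesis ie : independent e.

Let L (a : 'rV[R]_n) : X := \sum_j a 0 j *: e j.

Let LD a b : L (a + b) = L a + L b.
Proof.
by rewrite /L -big_split/=; apply: eq_bigr => j _; rewrite mxE scalerDl.
Qed.

Let LZ c a : L (c *: a) = c *: L a.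
Proof.
by rewrite /L scaler_sumr; apply: eq_bigr => j _; rewrite mxE scalerA.
Qed.

(** The matrix [M] stands for the map sending the basis vectors of the Euclidean
    space to the vectors of [X] whose coordinates are the rows of [M]. *)
Definition contraction (M : 'M[R]_n) := forall a, `|L (a *m M)| <= norm2 a.

(* The entries of a contraction are bounded, since [e] is independent. *)
Let det_bound : exists B : R, forall M, contraction M -> `|\det M| <= B.
Proof.
have [d d0 dP] := independent_lower ie.
exists (\sum_(s : 'S_n) \prod_(i < n) d^-1) => M cM.
apply: le_trans (ler_norm_sum _ _ _) _; apply: ler_sum => s _.
rewrite normrM normrX normrN normr1 expr1n mul1r normr_prod.
apply: ler_prod => i _; rewrite normr_ge0/=.
have := cM (delta_mx 0 i); rewrite -rowE /norm2.
have -> : dot (delta_mx 0 i) (delta_mx 0 i) = 1 :> R.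
  rewrite /dot (bigD1 i)//= mxE !eqxx mul1r big1 ?addr0// => k ki.
  by rewrite mxE (negPf ki) andbF mul0r.
rewrite sqrtr1 => h; have := le_trans (dP (fun j => row i M 0 j)) h.
rewrite -ler_pdivlMl// mulr1; apply: le_trans.
by rewrite (bigD1 (s i))//= mxE lerDl sumr_ge0.
Qed.

(** The factor 2 avoids the compactness argument that gives an exact
    maximum; it only affects the constant 1/8 below. *)
Definition near_maximal (M : 'M[R]_n) := [/\ contraction M, \det M != 0 &
  forall M', contraction M' -> `|\det M'| <= 2 * `|\det M|].

Lemma near_maximal_exists : exists M, near_maximal M.
Proof.
have [B BP] := det_bound.
pose D := [set `|\det M| | M in contraction].
have [M0 cM0 dM0] : exists2 M0, contraction M0 & \det M0 != 0.
  pose s := 1 + \sum_j `|e j|; have s0 : 0 < s by rewrite ltr_pwDl// sumr_ge0.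
  exists (s^-1)%:M; last by rewrite det_scalar expf_neq0// invr_eq0 gt_eqF.
  move=> a; rewrite mul_mx_scalar LZ normrZ gtr0_norm ?invr_gt0//.
  rewrite ler_pdivrMl//; apply: le_trans (ler_norm_sum _ _ _) _.
  apply: (@le_trans _ _ (\sum_j norm2 a * `|e j|)).
    by apply: ler_sum => j _; rewrite normrZ ler_wpM2r// norm2_coord.
  by rewrite -mulr_sumr mulrC ler_wpM2r ?norm2_ge0// lerDr.
have supD : has_sup D.
  by split; [exists `|\det M0|, M0|exists B => _ [M cM <-]; exact: BP].
have D0 : 0 < sup D.
  apply: (@lt_le_trans _ _ `|\det M0|); first by rewrite normr_gt0.
  by apply: ub_le_sup; [have [] := supD|exists M0].
have [_ [M cM <-]] := sup_adherent (divr_gt0 D0 (ltr0Sn R 1)) supD.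
move=> Mbig; exists M.
have h : sup D <= 2 * `|\det M| by lra.
split=> // [|M' cM'].
  by rewrite -normr_gt0; lra.
by apply: le_trans h; apply: ub_le_sup; [have [] := supD|exists M'].
Qed.

(** If [M] had norm less than 1/8 on the span of the last [n - j] basis vectors,
    multiplying these by 4 and the other ones by 1/2 would give another
    contraction, whose determinant is larger by the factor
    [4 ^ (n - j) / 2 ^ j]; this is at least 4 as [j < n / 2]. *)
Lemma near_maximal_large (k j : nat) (M : 'M[R]_n) : n = (k + k)%N ->
  (j < k)%N -> near_maximal M ->
  exists a : 'rV[R]_n, [/\ dot a a = 1,
    (forall i : 'I_n, (i < j)%N -> a 0 i = 0) &
    8^-1 <= `|L (a *m M)|].
Proof.
move=> nk jk [cM dM maxM]; apply: contrapT => h.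
have small (a : 'rV[R]_n) : (forall i : 'I_n, (i < j)%N -> a 0 i = 0) ->
    `|L (a *m M)| <= 8^-1 * norm2 a.
  move=> az; have [a0|a0] := eqVneq (norm2 a) 0.
    have -> : a = 0.
      apply/rowP => i; rewrite [RHS]mxE; apply/eqP; rewrite -normr_le0 -a0.
      exact: norm2_coord.
    have -> : L (0 *m M) = 0 by rewrite mul0mx -(scale0r 0) LZ scale0r.
    by rewrite normr0 mulr_ge0 ?norm2_ge0 ?invr_ge0.
  have a0' : 0 < norm2 a by rewrite lt_def a0 norm2_ge0.
  rewrite leNgt; apply/negP => aM; apply: h.
  exists ((norm2 a)^-1 *: a); split.
  - have -> : dot ((norm2 a)^-1 *: a) ((norm2 a)^-1 *: a) = (norm2 a) ^- 2 * dot a a.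
      by rewrite /dot mulr_sumr; apply: eq_bigr => i _; rewrite !mxE; field.
    by rewrite -[X in _ * X](sqr_sqrtr (dot_ge0 a)) mulVf// expf_neq0.
  - by move=> i ij; rewrite mxE az// mulr0.
  - rewrite -scalemxAl LZ normrZ gtr0_norm ?invr_gt0//.
    by rewrite ler_pdivlMl// mulrC ltW.
pose s : 'rV[R]_n := \row_i if (i < j)%N then 2^-1 else 4.
pose M' := diag_mx s *m M.
have cM' : contraction M'.
  move=> a; pose b : 'rV[R]_n := \row_i if (i < j)%N then 0 else a 0 i.
  have sb : a *m diag_mx s = 4 *: b + 2^-1 *: (a - b).
    apply/rowP => i; rewrite mul_mx_diag !mxE.
    by case: ifP => _; field.
  rewrite /M' mulmxA sb mulmxDl -!scalemxAl LD !LZ.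
  apply: le_trans (ler_normD _ _) _; rewrite !normrZ !ger0_norm ?invr_ge0//.
  have b1 : norm2 b <= norm2 a.
    by apply: norm2_le => i; rewrite mxE; case: ifP => // _; rewrite normr0.
  have b2 : norm2 (a - b) <= norm2 a.
    apply: norm2_le => i; rewrite !mxE; case: ifP => _; first by rewrite subr0.
    by rewrite subrr normr0.
  have h1 : `|L (b *m M)| <= 8^-1 * norm2 b.
    by apply: small => i ij; rewrite mxE ij.
  have h2 := cM (a - b).
  lra.
have := maxM _ cM'; rewrite det_mulmx normrM ler_pM2r ?normr_gt0//.
rewrite det_diag leNgt => /negP; apply.
have -> : \prod_i s 0 i = 2^-1 ^+ j * 4 ^+ (n - j).
  have jn : (j <= n)%N by rewrite nk (leq_trans (ltnW jk))// leq_addr.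
  rewrite (eq_bigr (fun i : 'I_n => if (i < j)%N then 2^-1 else 4)); last first.
    by move=> i _; rewrite mxE.
  rewrite -(big_mkord xpredT (fun i => if (i < j)%N then 2^-1 else 4 : R)).
  rewrite (big_cat_nat _ jn)//=; congr (_ * _).
    rewrite -[j in RHS]subn0 -prodr_const_nat big_nat_cond [RHS]big_nat_cond.
    by apply: eq_bigr => i /andP[/andP[_ ->]].
  rewrite -prodr_const_nat big_nat_cond [RHS]big_nat_cond.
  by apply: eq_bigr => i /andP[/andP[ji _] _]; rewrite ltnNge ji.
rewrite gtr0_norm; last by rewrite mulr_gt0 ?exprn_gt0 ?invr_gt0.
have -> : (n - j = j + (1 + (n - j - j - 1)))%N by lia.
rewrite !exprD mulrA -exprMn expr1.
have -> : 2^-1 * 4 = 2 :> R by field.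
have h1 : 1 <= 2 ^+ j :> R by rewrite exprn_ege1// ler1n.
have h2 : 1 <= 4 ^+ (n - j - j - 1) :> R by rewrite exprn_ege1// ler1n.
have := mulr_ege1 h1 h2; rewrite mulrCA; lra.
Qed.

Lemma near_maximal_rows (k j : nat) : n = (k + k)%N -> (j <= k)%N ->
  exists2 M, near_maximal M &
    forall i : 'I_n, (i < j)%N -> 8^-1 <= `|L (row i M)|.
Proof.
move=> nk; elim: j => [_|j IH jk]; first by have [M] := near_maximal_exists; exists M.
have [M maxM Mj] := IH (ltnW jk).
have [a [a1 az aM]] := near_maximal_large nk jk maxM.
have jn : (j < n)%N by rewrite nk (leq_trans jk)// leq_addr.
have [S [SS Sj Si]] := householder (Ordinal jn) a1.
have dS : `|\det S| = 1.
  have := congr1 determinant SS; rewrite det_mulmx det_tr det1 -expr2 => /eqP.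
  by rewrite sqrf_eq1 => /orP[] /eqP ->; rewrite ?normrN normr1.
have [cM dM lM] := maxM.
exists (S *m M); first split.
- by move=> b; rewrite mulmxA; apply: le_trans (cM _) _; rewrite norm2_isometry.
- by rewrite det_mulmx mulf_neq0// -normr_gt0 dS.
- by move=> M' /lM; rewrite det_mulmx normrM dS mul1r.
move=> i; rewrite ltnS leq_eqVlt => /predU1P[ij|ij].
  have -> : i = Ordinal jn by exact: val_inj.
  by rewrite row_mul Sj.
rewrite row_mul Si ?az//; first by rewrite -rowE; exact: Mj.
by rewrite neq_ltn ij.
Qed.

End Volume.

(** A linear map from a Euclidean space of dimension [2 k] that has norm at most
    1 and almost maximal determinant has norm at least 1/8 on each subspace of
    dimension more than [k], so that [k] orthonormal vectors with large images
    can be chosen successively. *)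
Lemma dvoretzky_rogers (X : normedModType R) : ~ finite_dimensional X ->
  forall k, exists x : 'I_k -> X, (forall i, 8^-1 <= `|x i|) /\
    forall c : 'I_k -> R, `|\sum_i c i *: x i| <= Num.sqrt (\sum_i c i ^+ 2).
Proof.
move=> Xinf k; have [e ie] := infinite_dim_independent Xinf (k + k).
have [M [cM _ _] Mk] := near_maximal_rows ie (erefl (k + k)%N) (leqnn k).
exists (fun i => \sum_j row (lshift k i) M 0 j *: e j); split=> [i|c].
  by apply: Mk; rewrite /= ltn_ord.
pose a : 'rV[R]_(k + k) := row_mx (\row_i c i) 0.
have := cM a; rewrite /norm2.
have -> : dot a a = \sum_i c i ^+ 2.
  rewrite /dot big_split_ord/= [X in _ + X]big1 ?addr0.
    by apply: eq_bigr => i _; rewrite row_mxEl mxE expr2.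
  by move=> i _; rewrite row_mxEr mxE mul0r.
congr (_ <= _); congr `|_|.
under [RHS]eq_bigr do rewrite scaler_sumr.
rewrite exchange_big/=; apply: eq_bigr => j _.
rewrite mxE big_split_ord/= [X in _ + X]big1 ?addr0.
  by rewrite scaler_suml; apply: eq_bigr => i _; rewrite row_mxEl !mxE scalerA.
by move=> i _; rewrite row_mxEr mxE mul0r.
Qed.

End DvoretzkyRogers.

(** * Almost diagonal submatrices *)

Section Selection.
Context {R : realType} {N : nat} (a : 'I_N -> 'I_N -> R).
Hypothesis a0 : forall i j, 0 <= a i j.

Let off (S : {set 'I_N}) i j := [&& i \in S, j \in S & j != i].

Let weight (S : {set 'I_N}) : R := \sum_i \sum_j (off S i j)%:R * a i j.

Let weight_remove (S : {set 'I_N}) m : #|S| = m.+2 ->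
  \sum_(v in S) weight (S :\ v) = m%:R * weight S.
Proof.
move=> Sm; rewrite exchange_big/= mulr_sumr; apply: eq_bigr => i _.
rewrite exchange_big/= mulr_sumr; apply: eq_bigr => j _.
rewrite -mulr_suml mulrA; congr (_ * _).
have [/and3P[iS jS ji]|nS] := boolP (off S i j); last first.
  rewrite mulr0 big1// => v vS; rewrite (_ : off _ _ _ = false)//.
  apply/negbTE; apply: contra nS => /and3P[].
  by rewrite !inE => /andP[_ iS] /andP[_ jS] ji; apply/and3P.
rewrite mulr1 (eq_bigr (fun v => ((v != i) && (v != j))%:R)); last first.
  move=> v vS; rewrite /off !inE iS jS ji !andbT.
  by rewrite (eq_sym i) (eq_sym j).
rewrite -natr_sum; congr _%:R; apply/eqP; rewrite -(eqn_add2r 2); apply/eqP.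
have -> : (m + 2 = #|S|)%N by rewrite Sm addn2.
rewrite (cardsD1 i S) (cardsD1 j (S :\ i)) !inE ji iS jS /= addnA addnC.
congr (_ + _)%N; rewrite -sum1_card big_mkcond [RHS]big_mkcond/=.
apply: eq_bigr => v _; rewrite !inE andbA [in RHS]andbC.
by case: (v \in S); case: (v != i); case: (v != j).
Qed.

(* When indices are removed one at a time so as to minimize the weight,
   averaging over the removed index shows that the weight divided by
   [#|S| * (#|S| - 1)] does not increase. *)
Let light_subset m : (m <= N)%N -> exists2 S : {set 'I_N}, #|S| = m &
  weight S * (N%:R * N.-1%:R) <= m%:R * m.-1%:R * weight [set: 'I_N]%SET.
Proof.
move=> mN; rewrite -(subKn mN); move: (N - m)%N (leq_subr m N) => d {m mN}.
elim: d => [_|d IH dN].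
  by rewrite subn0; exists [set: 'I_N]%SET; rewrite ?cardsT ?card_ord// mulrC.
have [S Sm SP] := IH (ltnW dN).
have eS : (N - d)%N = (N - d.+1).+1 by lia.
rewrite eS in Sm SP; move: (N - d.+1)%N Sm SP => m Sm SP {IH dN eS}.
have T0 : 0 <= weight [set: 'I_N]%SET.
  by apply: sumr_ge0 => i _; apply: sumr_ge0 => j _; rewrite mulr_ge0.
have [v0 v0S] : exists v, v \in S by apply/set0Pn; rewrite -card_gt0 Sm.
have card v : v \in S -> #|S :\ v| = m.
  by move=> vS; apply/eqP; rewrite -eqSS -Sm (cardsD1 v S) vS.
case: m Sm SP card => [|m] Sm SP card.
  exists (S :\ v0); first exact: card.
  rewrite (_ : weight _ = 0) ?mul0r//; apply: big1 => i _; apply: big1 => j _.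
  rewrite (_ : off _ _ _ = false) ?mul0r//.
  by rewrite (cards0_eq (card _ v0S)) /off !inE.
have [v vS vP] : exists2 v, v \in S & m.+2%:R * weight (S :\ v) <= m%:R * weight S.
  apply: contrapT => h.
  have : \sum_(v in S) m%:R * weight S < \sum_(v in S) m.+2%:R * weight (S :\ v).
    apply: ltr_sum; first by apply/hasP; exists v0; rewrite ?mem_index_enum.
    by move=> v vS; rewrite ltNge; apply/negP => vP; apply: h; exists v.
  rewrite -!mulr_sumr (weight_remove Sm) sumr_const Sm.
  by rewrite -[weight S *+ _]mulr_natl mulrCA ltxx.
exists (S :\ v); first exact: card.
have n2 : 0 < m.+2%:R :> R by [].
have NN : 0 <= N%:R * N.-1%:R :> R by rewrite mulr_ge0.
have m0 : 0 <= m%:R :> R by [].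
have h1 := ler_wpM2r NN vP; have h2 := ler_wpM2l m0 SP.
rewrite -(ler_pM2l n2) (mulrA m.+2%:R (weight _)); apply: le_trans h1 _.
rewrite -(mulrA m%:R (weight _)); apply: le_trans h2 _.
by rewrite /= le_eqVlt; apply/orP; left; apply/eqP; ring.
Qed.

(** An average subset of size [m] has off-diagonal sum at most
    [m (m - 1) / (N - 1)] for a matrix with row sums at most 1. *)
Lemma small_offdiagonal_subset (m : nat) (t : R) : 0 < t ->
  (forall i, \sum_j a i j <= 1) -> (m * m)%:R <= t * N.-1%:R -> (m <= N)%N ->
  exists s : 'I_m -> 'I_N, injective s /\
    forall k, \sum_(i | i != k) a (s k) (s i) <= t.
Proof.
move=> t0 a1 mt mN; have [S Sm SP] := light_subset mN.
have [N1|N1] := leqP N 1.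
  have h (i k : 'I_m) : i = k.
    by apply: val_inj => /=; have := ltn_ord i; have := ltn_ord k; lia.
  exists (widen_ord mN); split=> [i k|k]; first by move=> _; exact: h.
  by rewrite big_pred0 ?ltW// => i; rewrite (h i k) eqxx.
have wS : weight S <= t.
  have n0 : 0 < N.-1%:R :> R by rewrite ltr0n; lia.
  have nn : 0 < N%:R :> R by rewrite ltr0n; lia.
  have wT : weight [set: 'I_N]%SET <= N%:R.
    rewrite -[N in leRHS]card_ord -sumr_const; apply: ler_sum => i _.
    apply: le_trans (a1 i); apply: ler_sum => j _.
    by rewrite ler_piMl// lern1 leq_b1.
  rewrite -(ler_pM2r (mulr_gt0 nn n0)); apply: le_trans SP _.
  apply: (@le_trans _ _ ((m * m)%:R * N%:R)).
    apply: ler_pM => //.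
      by apply: sumr_ge0 => i _; apply: sumr_ge0 => j _; rewrite mulr_ge0.
    by rewrite -natrM ler_nat leq_mul2l leq_pred orbT.
  by rewrite mulrCA mulrC ler_wpM2l// ltW.
have cS : m = #|S| by [].
exists (fun i => enum_val (cast_ord cS i)); split.
  by move=> i k /enum_val_inj/cast_ord_inj.
move=> k; apply: le_trans wS; rewrite /weight.
set s := fun i => enum_val (cast_ord cS i).
have sinj : injective s by move=> i l /enum_val_inj/cast_ord_inj.
rewrite (bigD1 (s k))//= -[leLHS]addr0 lerD//; last first.
  by apply: sumr_ge0 => i _; apply: sumr_ge0 => j _; rewrite mulr_ge0.
rewrite [leRHS](_ : _ = \sum_(j in S | j != s k) a (s k) j); last first.
  rewrite [RHS]big_mkcond; apply: eq_bigr => j _.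
  by rewrite /off enum_valP /=; case: ifP => _; rewrite ?mul1r ?mul0r.
rewrite (reindex s)/=.
  rewrite le_eqVlt; apply/orP; left; apply/eqP; apply: eq_bigl => i.
  by rewrite enum_valP (inj_eq sinj).
exists (fun j => odflt k [pick i | s i == j]) => [i _|j /andP[jS _]].
  by case: pickP => [l /eqP/sinj //|/(_ i)]; rewrite eqxx.
case: pickP => [i /eqP//|h].
have := h (cast_ord (esym cS) (enum_rank_in jS j)).
by rewrite /s cast_ordKV enum_rankK_in ?eqxx.
Qed.

End Selection.

(** * Sequences of tensors equivalent to a supremum norm *)

Section DiagonalTensors.
Context {R : realType}.

Lemma tensor_pairing_sum (X Y : normedModType R) (f : dual X) (g : dual Y) n
    (c : 'I_n -> R) (x : 'I_n -> X) (y : 'I_n -> Y) :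
  tensor_pairing f g (\sum_i c i *: tens (x i) (y i)) =
  \sum_i c i * (f (x i) * g (y i)).
Proof.
have pZ : tensor_pairing f g 0 = 0.
  by have := tensor_pairingZ f g 0 0; rewrite scale0r mul0r.
rewrite (big_morph _ (tensor_pairingD f g) pZ); apply: eq_bigr => i _.
by rewrite tensor_pairingZ /tens tensor_pairing_pi big_seq1.
Qed.

(** Duality: evaluate [f] at the combination with coefficients [f (x i)]. *)
Lemma weakly_2summing (X : normedModType R) n (x : 'I_n -> X) (f : dual X) :
  (forall c : 'I_n -> R, `|\sum_i c i *: x i| <= Num.sqrt (\sum_i c i ^+ 2)) ->
  `|f| = 1 -> \sum_i f (x i) ^+ 2 <= 1.
Proof.
move=> xc f1; set S := \sum_i _.
have S0 : 0 <= S by apply: sumr_ge0 => i _; exact: sqr_ge0.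
have SE : f (\sum_i f (x i) *: x i) = S.
  by rewrite linear_sum; apply: eq_bigr => i _; rewrite linearZ expr2.
have h : S <= Num.sqrt S.
  have := dual_norm_le f (\sum_i f (x i) *: x i); rewrite f1 mul1r SE.
  by move=> /(le_trans (ler_norm _))/le_trans; apply; exact: xc.
have s0 := sqrtr_ge0 S; have s2 := sqr_sqrtr S0.
move: h s0 s2; set s := Num.sqrt S => h s0 s2; rewrite -s2 in h.
rewrite -s2 expr_le1//; rewrite leNgt; apply/negP => s1.
by have := ltr_pM2l (lt_trans ltr01 s1) 1 s; rewrite mulr1 s1 -expr2 ltNge h.
Qed.

(** Take [x_i (x) y_i] with Dvoretzky-Rogers vectors.  The upper estimate is the
    Cauchy-Schwarz inequality.  For the lower one, the tensor product of
    functionals norming [x_k] and [y_k] is at least 1/64 at the k-th tensor; the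
    sum of its absolute values at the other ones is at most 1, and is reduced
    to 1/128 by passing to a subset of the indices. *)
Lemma injective_tensor_sup_norm (X Y : normedModType R) (m : nat) :
  ~ finite_dimensional X -> ~ finite_dimensional Y ->
  exists z : 'I_m -> tensor X Y,
    (forall (c : 'I_m -> R) (B : R), 0 <= B -> (forall i, `|c i| <= B) ->
       inj_norm (\sum_i c i *: z i) <= B) /\
    (forall (c : 'I_m -> R) k, `|c k| <= 128 * inj_norm (\sum_i c i *: z i)).
Proof.
(* [N] is such that the off-diagonal row sums become at most 1/128. *)
move=> Xinf Yinf; pose N := (128 * (m * m)).+1.
have [x [x8 xc]] := dvoretzky_rogers Xinf N.
have [y [y8 yc]] := dvoretzky_rogers Yinf N.
have sum1 (f : dual X) (g : dual Y) : `|f| = 1 -> `|g| = 1 ->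
    \sum_i `|f (x i) * g (y i)| <= 1.
  move=> f1 g1; have hf := weakly_2summing xc f1; have hg := weakly_2summing yc g1.
  apply: (@le_trans _ _ (\sum_i (f (x i) ^+ 2 + g (y i) ^+ 2) / 2)).
    apply: ler_sum => i _; rewrite ler_norml.
    have := sqr_ge0 (f (x i) - g (y i)); have := sqr_ge0 (f (x i) + g (y i)).
    by move=> h1 h2; apply/andP; split; lra.
  by rewrite -mulr_suml big_split/=; lra.
have upper n (s : 'I_n -> 'I_N) (c : 'I_n -> R) (B : R) : injective s ->
    0 <= B -> (forall i, `|c i| <= B) ->
    inj_norm (\sum_i c i *: tens (x (s i)) (y (s i))) <= B.
  move=> si B0 cB; apply: inj_norm_lub => // f g f1 g1.
  rewrite tensor_pairing_sum; apply: le_trans (ler_norm_sum _ _ _) _.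
  apply: (@le_trans _ _ (B * \sum_i `|f (x (s i)) * g (y (s i))|)).
    by rewrite mulr_sumr; apply: ler_sum => i _; rewrite normrM ler_wpM2r.
  rewrite -[leRHS]mulr1 ler_wpM2l//; apply: le_trans (sum1 f g f1 g1).
  rewrite -(big_imset (fun j => `|f (x j) * g (y j)|)) /=; last first.
    by move=> i j _ _; exact: si.
  by rewrite [leRHS](bigID (mem [set s i | i in 'I_n]%SET))/= lerDl sumr_ge0.
have x0 i : x i != 0.
  by rewrite -normr_gt0; apply: lt_le_trans (x8 i); rewrite invr_gt0.
have y0 i : y i != 0.
  by rewrite -normr_gt0; apply: lt_le_trans (y8 i); rewrite invr_gt0.
have hf i : exists f : dual X, `|f| = 1 /\ f (x i) = `|x i|.
  by have [f] := norming_dual (x0 i); exists f.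
have hg i : exists g : dual Y, `|g| = 1 /\ g (y i) = `|y i|.
  by have [g] := norming_dual (y0 i); exists g.
have [f fP] := choice hf; have [g gP] := choice hg.
pose a i j := `|f i (x j) * g i (y j)|.
have [|||||s [si sP]] := @small_offdiagonal_subset R N a _ m 128^-1.
- by move=> i j; exact: normr_ge0.
- by rewrite invr_gt0.
- by move=> i; apply: sum1; [exact: (fP i).1|exact: (gP i).1].
- by rewrite [N.-1]/= (natrM _ 128) mulrA mulVf ?mul1r.
- by rewrite /N; clear; nia.
exists (fun i => tens (x (s i)) (y (s i))); split=> [c B|c k].
  exact: upper.
pose k0 := [arg max_(i > k) `|c i|]%O.
have k0P i : `|c i| <= `|c k0|.
  by rewrite /k0; case: arg_maxP => // j _; apply.
apply: le_trans (k0P k) _.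
have := inj_norm_ub (\sum_i c i *: tens (x (s i)) (y (s i)))
  (fP (s k0)).1 (gP (s k0)).1.
rewrite tensor_pairing_sum (bigD1 k0)//=.
rewrite (fP (s k0)).2 (gP (s k0)).2.
set r := \sum_(i | _) _; have rB : `|r| <= `|c k0| * 128^-1.
  apply: le_trans (ler_norm_sum _ _ _) _.
  apply: (@le_trans _ _ (\sum_(i | i != k0) `|c k0| * a (s k0) (s i))).
    by apply: ler_sum => i _; rewrite normrM ler_wpM2r.
  by rewrite -mulr_sumr ler_wpM2l.
have d64 : 64^-1 <= `|x (s k0)| * `|y (s k0)|.
  apply: (@le_trans _ _ (8^-1 * 8^-1)); first by rewrite -invfM -natrM.
  by apply: ler_pM; rewrite ?invr_ge0.
have := ler_wpM2l (normr_ge0 (c k0)) d64.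
have := lerB_dist (c k0 * (`|x (s k0)| * `|y (s k0)|)) (- r).
rewrite opprK normrN normrM [`|_ * `|_| |]ger0_norm ?mulr_ge0//.
by move=> h1 h2 h3; lra.
Qed.

End DiagonalTensors.

(** * Infinite-dimensional factors *)

Section SupNormCompletion.
Context {R : realType}.

(** Polynomials stand for finitely supported sequences, so that the completion
    is isomorphic to c_0.  A weak limit [w] of the bounded sequence of the
    partial sums of the basis would have all its coordinates equal to 1, but
    [w] is near some [q], whose coordinates beyond its size vanish. *)
Lemma sup_norm_completion_not_reflexive (p : seminorm {poly R}) (K : R) :
  (forall (q : {poly R}) (B : R), 0 <= B -> (forall i, `|q`_i| <= B) -> p q <= B) ->
  (forall (q : {poly R}) i, `|q`_i| <= K * p q) ->
  ~ reflexive_space (completion p).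
Proof.
move=> pU pK refl; have [U UU oU] := free_ultrafilter.
pose s n : {poly R} := \poly_(i < n) 1.
have ps n : p (s n) <= 1.
  by apply: pU => // i; rewrite coef_poly; case: ifP; rewrite ?normr1 ?normr0.
have fs (f : dual (completion p)) n : `|f (to_completion p (s n))| <= `|f|.
  apply: le_trans (dual_norm_le _ _) _; rewrite to_completion_norm.
  by rewrite -[leRHS]mulr1 ler_wpM2l.
have phi_cvg (f : dual (completion p)) :
    f (to_completion p (s n)) @[n --> U] -->
    ulim U (fun n => f (to_completion p (s n))).
  by apply: (@ulim_cvg _ _ _ _ _ `|f|); apply: nearW => n; exact: fs.
pose phi (f : dual (completion p)) : R^o :=
  ulim U (fun n => f (to_completion p (s n))).
have phil : linear phi.
  move=> a f g; apply: ulim_eq.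
  apply: (@cvgD _ R^o _ U _ (fun n => a *: f _) (fun n => g _)).
    by apply: cvgZr; exact: phi_cvg.
  exact: phi_cvg.
have phib f : `|phi f| <= 1 * `|f|.
  rewrite mul1r.
  apply: (ler_cvg_filter (cvg_norm (phi_cvg f)) (cvg_cst `|f|)).
  by apply: nearW => n; exact: fs.
have [Phi PhiE _] := bounded_linear_dual ler01 phil phib.
have [w wP] := refl Phi.
have K0 : 0 < K.
  have := pK 1 0%N; rewrite coef1 eqxx normr1 => h; rewrite ltNge; apply/negP => K0.
  have := le_trans h (mulr_le0_ge0 K0 (seminorm_ge0 p 1)); rewrite ler10 //.
have Ki : 0 < K^-1 by rewrite invr_gt0.
have [q wq] := to_completion_dense w Ki.
pose c (r : {poly R}) : R^o := r`_(size q).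
have cl : linear c by move=> a r r'; rewrite /c coefD coefZ.
pose c' : {linear {poly R} -> R^o} := HB.pack c (GRing.isLinear.Build _ _ _ _ c cl).
have [F FE FK] := @completion_dual R _ p c' K (ltW K0) (fun r => pK r _).
have Fw : F w = 1.
  have one : (fun=> 1 : R) n @[n --> U] --> (1 : R) by exact: cvg_cst.
  rewrite -wP PhiE; apply: ulim_eq.
  apply: (cvg_trans _ one); apply: near_eq_cvg; apply: oU.
  exists (size q).+1 => // n /= qn.
  by rewrite FE /= /c coef_poly qn.
have Fq : F (to_completion p q) = 0 by rewrite FE /= /c nth_default.
have := dual_norm_le F (w - to_completion p q).
rewrite linearB /= Fw Fq subr0 normr1 => h.
have : `|F| * `|w - to_completion p q| < K * K^-1.
  apply: (@le_lt_trans _ _ (K * `|w - to_completion p q|)); first by rewrite ler_wpM2r.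
  by rewrite ltr_pM2l.
by rewrite mulfV ?gt_eqF// ltNge h.
Qed.

(** The limit of the norms of the finite sequences given by
    [injective_tensor_sup_norm] is equivalent to the supremum norm. *)
Lemma injective_tensor_not_superreflexive (X Y : normedModType R) :
  ~ finite_dimensional X -> ~ finite_dimensional Y ->
  ~ superreflexive (injective_tensor X Y).
Proof.
move=> Xinf Yinf sV; have [U UU oU] := free_ultrafilter.
pose z m := sval (cid (injective_tensor_sup_norm m Xinf Yinf)).
have zU m (c : 'I_m -> R) (B : R) : 0 <= B -> (forall i, `|c i| <= B) ->
    inj_norm (\sum_i c i *: z m i) <= B.
  by have [h _] := svalP (cid (injective_tensor_sup_norm m Xinf Yinf)); exact: h.
have zL m (c : 'I_m -> R) k : `|c k| <= 128 * inj_norm (\sum_i c i *: z m i).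
  by have [_ h] := svalP (cid (injective_tensor_sup_norm m Xinf Yinf)); exact: h.
pose A m (q : {poly R}) : injective_tensor X Y :=
  to_completion (inj_seminorm X Y) (\sum_(i < m) q`_i *: z m i).
have AE m q : `|A m q| = inj_norm (\sum_(i < m) q`_i *: z m i).
  exact: to_completion_norm.
have Alin (a : R) (q r : {poly R}) :
    \forall m \near U, A m (a *: q + r) = a *: A m q + A m r.
  apply: nearW => m; rewrite /A -linearP; congr (to_completion _ _).
  rewrite scaler_sumr -big_split/=; apply: eq_bigr => i _.
  by rewrite coefD coefZ scalerDl scalerA.
have AB (q : {poly R}) (B : R) : 0 <= B -> (forall i, `|q`_i| <= B) ->
    forall m, `|A m q| <= B.
  by move=> B0 qB m; rewrite AE; exact: zU.
have Abnd (q : {poly R}) : exists M : R, \forall m \near U, `|A m q| <= M.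
  exists (\sum_(i < size q) `|q`_i|); apply: nearW; apply: AB.
    by rewrite sumr_ge0.
  move=> i; have [iq|iq] := ltnP i (size q).
    by rewrite (bigD1 (Ordinal iq))//= lerDl sumr_ge0.
  by rewrite nth_default// normr0 sumr_ge0.
pose p := @ultra_seminorm R nat U UU (injective_tensor X Y) {poly R} A Alin Abnd.
have pcvg q : `|A m q| @[m --> U] --> p q by exact: ultra_seminorm_cvg.
apply: (@sup_norm_completion_not_reflexive p 128) => [q B B0 qB|q i|].
- apply: (ler_cvg_filter (pcvg q) (cvg_cst B)).
  by apply: nearW; exact: AB.
- have h : 128 * `|A m q| @[m --> U] --> 128 * p q by exact: cvgMr.
  apply: (ler_cvg_filter (cvg_cst `|q`_i|) h); apply: oU.
  exists i.+1 => // m /= im; rewrite AE.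
  exact: (zL m (fun i : 'I_m => q`_i) (Ordinal im)).
- by apply: sV; exact: ultra_completion_finitely_representable.
Qed.

End SupNormCompletion.

(** * A finite-dimensional factor *)

Section FiniteDimensionalFactor.
Context {R : realType}.

Lemma tensor_pairing_dual (X Y : normedModType R) (f : dual X) (g : dual Y) u :
  `|tensor_pairing f g u| <= `|f| * `|g| * inj_norm u.
Proof.
have pE (a b : R) (f' : dual X) (g' : dual Y) :
    tensor_pairing (a *: f') (b *: g') u = a * b * tensor_pairing f' g' u.
  elim/quotW: u => u; rewrite !tensor_pairing_pi mulr_sumr.
  by apply: eq_bigr => p _; rewrite !dualZE mulrACA.
have z0 (a b : R) (f' : dual X) (g' : dual Y) : f = a *: f' -> g = b *: g' ->
    a * b = 0 -> `|tensor_pairing f g u| <= `|f| * `|g| * inj_norm u.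
  move=> -> -> ab; rewrite pE ab mul0r normr0.
  by rewrite !mulr_ge0 ?inj_norm_ge0.
have [f0|f0] := eqVneq f 0.
  by apply: (z0 0 1 f g); rewrite ?mul0r ?scale1r ?scale0r.
have [g0|g0] := eqVneq g 0.
  by apply: (z0 1 0 f g); rewrite ?mulr0 ?scale1r ?scale0r.
have nf : `|f| != 0 by rewrite normr_eq0.
have ng : `|g| != 0 by rewrite normr_eq0.
have := @inj_norm_ub R X Y (`|f|^-1 *: f) (`|g|^-1 *: g) u.
rewrite !normrZ !normfV !normr_id !mulVf// => /(_ erefl erefl).
rewrite pE normrM normrM !normfV !normr_id -invfM ler_pdivrMl//.
by rewrite mulr_gt0// normr_gt0.
Qed.

(** A norm estimate by bounded maps extends from a dense subspace. *)
Lemma completion_norm_le (E : lmodType R) (p : seminorm E) (Y : normedModType R)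
    n (B : 'I_n -> {linear completion p -> Y}) (C K : R) : 0 <= K ->
  (forall i v, `|B i v| <= C * `|v|) ->
  (forall x, p x <= K * \sum_i `|B i (to_completion p x)|) ->
  forall v, `|v| <= K * \sum_i `|B i v|.
Proof.
move=> K0 BC pK v; apply/ler_addgt0Pl => t t0.
pose M : R := 1 + K * \sum_(i < n) `|C|.
have M0 : 0 < M by rewrite ltr_pwDl// mulr_ge0 ?sumr_ge0.
have [x vx] := to_completion_dense v (divr_gt0 t0 M0).
have h1 : `|v| <= `|v - to_completion p x| + p x.
  by rewrite -to_completion_norm -{1}(subrK (to_completion p x) v) ler_normD.
have h2 i : `|B i (to_completion p x)| <=
    `|B i v| + `|C| * `|v - to_completion p x|.
  rewrite -{1}(subKr v (to_completion p x)) linearB.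
  apply: le_trans (ler_normB _ _) _; rewrite lerD2l.
  by apply: le_trans (BC i _) _; rewrite ler_wpM2r// ler_norm.
have h3 : p x <=
    K * (\sum_i `|B i v| + (\sum_(i < n) `|C|) * `|v - to_completion p x|).
  apply: le_trans (pK x) _; rewrite ler_wpM2l// mulr_suml -big_split/=.
  exact: ler_sum.
have h4 : M * `|v - to_completion p x| <= t by rewrite mulrC -ler_pdivlMr// ltW.
apply: le_trans h1 _; apply: le_trans (lerD (lexx _) h3) _.
by rewrite mulrDr addrCA addrC lerD2r (le_trans _ h4)// /M mulrDl mul1r mulrA.
Qed.

(** With a basis [e] of [X] and its dual basis, a tensor [u] is the sum of the
    [e_i (x) P_i u], where [P_i] applies the i-th coordinate to the left factor;
    so the norm of [u] is equivalent to the sum of the norms of the [P_i u]. *)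
Lemma superreflexive_injective_tensor_fin_dim (X : normedModType R)
    (Y : completeNormedModType R) :
  finite_dimensional X -> superreflexive Y -> superreflexive (injective_tensor X Y).
Proof.
move=> /fin_dim_basis[n [e [ie Xe]]] sY.
have [k kE] := coordinates ie; have [d d0 dP] := independent_lower ie.
have xE x : x = \sum_i k x i *: e i.
  by have : [set: X] x by []; rewrite Xe => -[c _ <-]; rewrite kE.
have kl i : linear (fun x => k x i : R^o).
  move=> a x y.
  have -> : a *: x + y = \sum_i (a * k x i + k y i) *: e i.
    rewrite {1}(xE x) {1}(xE y) scaler_sumr -big_split/=.
    by apply: eq_bigr => j _; rewrite scalerDl scalerA.
  by rewrite kE.
have di : 0 <= d^-1 by rewrite invr_ge0 ltW.
have kb i x : `|k x i| <= d^-1 * `|x|.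
  rewrite ler_pdivlMl// {2}(xE x); apply: le_trans (dP _).
  by rewrite ler_pM2l// (bigD1 i)//= lerDl sumr_ge0.
have he i : exists F : dual X, (forall x, F x = k x i) /\ `|F| <= d^-1.
  by have [F FE FC] := bounded_linear_dual di (kl i) (kb i); exists F.
have [F FP] := choice he.
pose b i (x : X) (y : Y) : Y := F i x *: y.
have bl i y : linear ((b i)^~ y).
  by move=> a x x'; rewrite /b linearP scalerDl; congr (_ + _); exact/esym/scalerA.
have br i x : linear (b i x).
  by move=> a y y'; rewrite /b scalerDr !scalerA mulrC.
have Pl i : linear (tensor_lift (b i)).
  move=> a u v; rewrite (tensor_liftD (bl i) (br i)).
  by rewrite (tensor_liftZ (bl i) (br i)).
pose P i : {linear tensor X Y -> Y} :=
  HB.pack (tensor_lift (b i)) (GRing.isLinear.Build _ _ _ _ _ (Pl i)).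
have gP i (g : dual Y) u : g (P i u) = tensor_pairing (F i) g u.
  elim/quotW: u => u; rewrite tensor_pairing_pi /= (tensor_lift_pi (bl i) (br i)).
  by rewrite linear_sum; apply: eq_bigr => p _; rewrite linearZ.
have Pb i u : `|P i u| <= d^-1 * inj_seminorm X Y u.
  have [->|Pu] := eqVneq (P i u) 0.
    by rewrite normr0 mulr_ge0//; exact: inj_norm_ge0.
  have [g g1 gu] := norming_dual Pu.
  rewrite -gu gP; apply: le_trans (ler_norm _) _.
  apply: le_trans (tensor_pairing_dual _ _ _) _; rewrite g1 mulr1.
  by rewrite ler_wpM2r ?inj_norm_ge0//; exact: (FP i).2.
pose K := \sum_i `|e i|; have K0 : 0 <= K by apply: sumr_ge0.
have uP u : inj_seminorm X Y u <= K * \sum_i `|P i u|.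
  apply: inj_norm_lub => [|f g f1 g1]; first by rewrite mulr_ge0 ?sumr_ge0.
  have -> : tensor_pairing f g u = \sum_i f (e i) * g (P i u).
    under eq_bigr do rewrite gP.
    elim/quotW: u => u; rewrite tensor_pairing_pi.
    under [RHS]eq_bigr do rewrite tensor_pairing_pi mulr_sumr.
    rewrite exchange_big/=; apply: eq_bigr => p _.
    rewrite {1}(xE p.1) linear_sum mulr_suml; apply: eq_bigr => i _.
    by rewrite linearZ /= (FP i).1 -[k _ _ *: _]/(k _ _ * _) mulrA [f _ * _]mulrC.
  apply: le_trans (ler_norm_sum _ _ _) _; rewrite mulr_sumr.
  apply: ler_sum => i _; rewrite normrM ler_pM//.
    apply: le_trans (dual_norm_le f (e i)) _; rewrite f1 mul1r.
    by rewrite /K (bigD1 i)//= lerDl sumr_ge0.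
  by have := dual_norm_le g (P i u); rewrite g1 mul1r.
have hB i : exists B : {linear injective_tensor X Y -> Y},
    (forall u, B (to_completion _ u) = P i u) /\ forall v, `|B v| <= d^-1 * `|v|.
  have [B [Bl BE BC]] := completion_extend di (Pb i).
  pose B' : {linear injective_tensor X Y -> Y} :=
    HB.pack B (GRing.isLinear.Build _ _ _ _ B Bl).
  by exists B'.
have [B BP] := choice hB.
have vB (v : injective_tensor X Y) : `|v| <= K * \sum_i `|B i v|.
  apply: (completion_norm_le K0 (fun i => (BP i).2)) => u.
  by under eq_bigr do rewrite (BP _).1; exact: uP.
have C0 : 0 < 1 + d^-1 + K by rewrite ltr_pwDl// ltr_pwDl.
apply: (superreflexive_embed (P := B) C0) sY => [i v|v].
  apply: le_trans ((BP i).2 v) _; rewrite ler_wpM2r//; lra.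
apply: le_trans (vB v) _; rewrite ler_wpM2r ?sumr_ge0//; lra.
Qed.

(** The exchange of the factors is isometric, since it exchanges the two
    functionals in the pairing. *)
Lemma superreflexive_injective_tensor_flip (X Y : normedModType R) :
  superreflexive (injective_tensor Y X) -> superreflexive (injective_tensor X Y).
Proof.
pose b (x : X) (y : Y) : tensor Y X := tens y x.
have bl y : linear (b^~ y) by move=> a x x'; rewrite /b tensDr tensZr.
have br x : linear (b x) by move=> a y y'; rewrite /b tensDl tensZl.
have fl : linear (tensor_lift b).
  by move=> a u v; rewrite (tensor_liftD bl br) (tensor_liftZ bl br).
have fP (f : dual X) (g : dual Y) u :
    tensor_pairing g f (tensor_lift b u) = tensor_pairing f g u.
  elim/quotW: u => u; rewrite tensor_pairing_pi (tensor_lift_pi bl br) /b.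
  have pZ : tensor_pairing g f 0 = 0.
    by have := tensor_pairingZ g f 0 0; rewrite scale0r mul0r.
  rewrite (big_morph _ (tensor_pairingD g f) pZ); apply: eq_bigr => p _.
  by rewrite /tens tensor_pairing_pi big_seq1 mulrC.
have fN u : inj_norm (tensor_lift b u) = inj_norm u.
  apply/eqP; rewrite eq_le; apply/andP; split; apply: inj_norm_lub => [|f g f1 g1];
    rewrite ?inj_norm_ge0//.
    by rewrite fP inj_norm_ub.
  by rewrite -fP inj_norm_ub.
pose l (u : tensor X Y) : injective_tensor Y X :=
  to_completion (inj_seminorm Y X) (tensor_lift b u).
have ll : linear l by move=> a u v; rewrite /l fl linearP.
pose A : {linear tensor X Y -> injective_tensor Y X} :=
  HB.pack l (GRing.isLinear.Build _ _ _ _ l ll).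
have AE u : `|A u| = inj_seminorm X Y u by rewrite /= /l to_completion_norm /= fN.
have [|B [Bl BE BC]] := @completion_extend R _ (inj_seminorm X Y) _ A 1 ler01.
  by move=> u; rewrite AE mul1r.
pose B' : {linear injective_tensor X Y -> injective_tensor Y X} :=
  HB.pack B (GRing.isLinear.Build _ _ _ _ B Bl).
apply: (@superreflexive_embed R _ _ 1 (fun=> B') 1) => // v.
apply: (@completion_norm_le _ _ _ 1 (fun=> B') 1 1) => // u.
by rewrite mul1r big_ord1 /= BE AE.
Qed.

End FiniteDimensionalFactor.

Theorem theorem1p2 (R : realType) (X Y : completeNormedModType R)
    (hX : superreflexive X) (hY : superreflexive Y) :
  superreflexive (injective_tensor X Y) <->
  (finite_dimensional X \/ finite_dimensional Y).
Proof.
split=> [sXY|[fX|fY]].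
- apply: contrapT => /not_orP[Xinf Yinf].
  exact: (injective_tensor_not_superreflexive Xinf Yinf sXY).
- exact: superreflexive_injective_tensor_fin_dim.
- apply: superreflexive_injective_tensor_flip.
  exact: superreflexive_injective_tensor_fin_dim.
Qed.
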